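(* Let $\mathcal{C}^{\circ,\bullet}$ be a category of colored partitions, let $N$ be an integer and let $\mathbb{G}$ be the associated unitary easy quantum group. Then, for any projective colored partitions $p,q\in\mathcal{C}^{\circ,\bullet}$, we have $$u_p\otimes u_q=\sum_{m\in X_{\mathcal{C}^{\circ,\bullet}}(p,q)}u_m,$$ with $$X_{\mathcal{C}^{\circ,\bullet}}(p,q)=Y^{\circ,\bullet}(p,q)\cap\mathcal{C}^{\circ,\bullet}.$$
   Context: Colored partitions. A colored partition on $k$ upper points ($1,\dots,k$ from left to right) and $l$ lower points ($1',\dots,l'$) is a set-partition of the disjoint union of these points into blocks, together with a color (white or black) for each point; $P^{\circ,\bullet}(k,l)$ is the set of these. A through-block is a block containing both upper and lower points; $t(p)$ is the number of through-blocks and $\beta(p)$ the number of other blocks. Colorings of a row of $k$ points are identified with words of length $k$ over $\mathbb{Z}_2=\{0,1\}$ (white $=0$, black $=1$). Operations: $p\otimes q$ is horizontal concatenation; $p^{*}$ is $p$ turned upside down; the composition $qp$ ($p$ on top, $q$ below, middle points identified and then removed) is defined when the lower coloring of $p$ equals the upper coloring of $q$; a rotation moves the leftmost (or rightmost) point of one row to the leftmost (resp. rightmost) position of the other row, keeping the blocks but changing the color of the moved point. The white identity is the one-block partition on one upper and one lower point, both white. A category of colored partitions $\mathcal{C}^{\circ,\bullet}$ is a collection of sets $\mathcal{C}^{\circ,\bullet}(k,l)\subseteq P^{\circ,\bullet}(k,l)$, $k,l\ge 0$, closed under these operations and containing the white identity. A colored partition $p$ is projective if $pp=p=p^{*}$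 (so its upper and lower colorings coincide and are called its coloring). For projective $p,q$ with the same coloring, $q\preceq p$ means $pq=q$, and $q\prec p$ means $q\preceq p$, $q\neq p$. Linear maps. For $p\in P^{\circ,\bullet}(k,l)$, $T_p:(\mathbb{C}^N)^{\otimes k}\to(\mathbb{C}^N)^{\otimes l}$ is $T_p(e_{i_1}\otimes\cdots\otimes e_{i_k})=N^{-\beta(p)/2}\sum_{j_1,\dots,j_l=1}^N\delta_p(i,j)\,e_{j_1}\otimes\cdots\otimes e_{j_l}$, where $e_1,\dots,e_N$ is the canonical basis of $\mathbb{C}^N$ and $\delta_p(i,j)=1$ if, labelling upper points by $i$ and lower points by $j$, points in a common block have equal labels, and $\delta_p(i,j)=0$ otherwise (the coloring is ignored). Unitary easy quantum groups. For a representation $u$ put $u^0=u$, $u^1=\overline{u}$ (contragredient) and, for a word $w=w_1\cdots w_k$, $u^w=u^{w_1}\otimes\cdots\otimes u^{w_k}$. The unitary easy quantum group associated with $\mathcal{C}^{\circ,\bullet}$ and $N$ is the unique compact quantum group $\mathbb{G}$ with $N$-dimensional fundamental representation $u$ such that for all words $w,w'$ of lengths $k,l$, $\mathrm{Hom}(u^w,u^{w'})$ is spanned by the $T_p$ with $p\in\mathcal{C}^{\circ,\bullet}(k,l)$ of upper coloring $w$ and lower coloring $w'$. Representations $u_p$. For a projective $p\in\mathcal{C}^{\circ,\bullet}$ with coloring $w$, let $P_p=T_p-\bigvee_{q\prec p}T_q$, the supremum being over projective $q\in\mathcal{C}^{\circ,\bullet}$ with $q\prec p$, taken among projections of $\mathrm{Hom}(u^w,u^w)$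 (and $0$ if there is no such $q$), and let $u_p=(\iota\otimes P_p)(u^w)$ be the subrepresentation of $u^w$ on the range of $P_p$, where $\iota$ is the identity of $C(\mathbb{G})$. Sums of representations. The sum sign does not assert an orthogonal direct sum; it means that a subrepresentation of the left-hand side containing all the summands is equal to the left-hand side. The set $X$. $X_{\mathcal{C}^{\circ,\bullet}}(p,q)$ is the set of projective $m\in\mathcal{C}^{\circ,\bullet}$ with $m\preceq p\otimes q$ such that $m\not\preceq l\otimes q$ for every projective $l\in\mathcal{C}^{\circ,\bullet}$ with $l\prec p$ and $m\not\preceq p\otimes r$ for every projective $r\in\mathcal{C}^{\circ,\bullet}$ with $r\prec q$. The set $Y^{\circ,\bullet}$. A colored building partition is $s\in P^{\circ,\bullet}(k,l)$ with any coloring on the upper row and only white points on the lower row, such that its lower points lie in pairwise different blocks, each lower point $x'$ is connected to at least one upper point (let $\min_{\mathrm{up}}(x')$ be the smallest such), and $\min_{\mathrm{up}}(c')<\min_{\mathrm{up}}(d')$ whenever $c'<d'$. Each projective colored $p\in P^{\circ,\bullet}(k,k)$ is uniquely $p=p_u^{*}p_u$ with $p_u\in P^{\circ,\bullet}(k,t(p))$ a colored building partition. A $(k,l)$-mixing partition (all points white) is a projective partition $h$ on $k+l$ upper and $k+l$ lower points, all of whose blocks have size $2$ or $4$, where blocks of size $2$ are of the form $\{x,x'\}$, or $\{x,y\}$ with $x\le k<y$, or $\{x',y'\}$ with $x\le k<y$, and blocks of size $4$ are of the form $\{x,x',y,y'\}$ with $x\le k<y$. Put $p\ast_hq=(p_u^{*}\otimes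 q_u^{*})h(p_u\otimes q_u)$ for a $(t(p),t(q))$-mixing partition $h$. $Y^{\circ,\bullet}(p,q)$ is the set of all such $p\ast_h q$. *)

(* Defs.v *)
From HB Require Import structures.
From mathcomp Require Import all_boot all_order all_algebra.

Set Implicit Arguments.
Unset Strict Implicit.
Unset Printing Implicit Defensive.

(* [inl i] is an upper point and [inr j] a lower one, numbered from 0. *)
Definition pt (k l : nat) : finType := ('I_k + 'I_l)%type.

(* Colors: [false] is white (the letter 0), [true] is black (the letter 1). *)
Record cpart (k l : nat) := CPart {
  cpart_val : ({set {set pt k l}} * {ffun pt k l -> bool})%type;
  cpartP : partition cpart_val.1 [set: pt k l] }.

HB.instance Definition _ k l := [isSub for @cpart_val k l].
HB.instance Definition _ k l := [Finite of cpart k l by <:].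

Definition word (k : nat) := {ffun 'I_k -> bool}.

Definition blocks k l (p : cpart k l) : {set {set pt k l}} := (cpart_val p).1.

Definition color k l (p : cpart k l) : {ffun pt k l -> bool} := (cpart_val p).2.

Definition ucol k l (p : cpart k l) : word k := [ffun i => color p (inl i)].

Definition lcol k l (p : cpart k l) : word l := [ffun j => color p (inr j)].

Definition linked k l (p : cpart k l) : rel (pt k l) :=
  fun x y => y \in pblock (blocks p) x.

Lemma linked_equivalence k l (p : cpart k l) : equivalence_rel (linked p).
Proof.
have pP := cpartP p.
by move=> x y z; apply: (pblock_equivalence pP); rewrite in_setT.
Qed.

Lemma part_of_rel_subproof k l (e : rel (pt k l)) (c : {ffun pt k l -> bool}) :
  equivalence_rel e -> partition (equivalence_partition e setT, c).1 [set: pt k l].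
Proof. by move=> eP; apply: equivalence_partitionP => x y z _ _ _; apply: eP. Qed.

Definition part_of_rel k l (e : rel (pt k l)) (eP : equivalence_rel e)
    (c : {ffun pt k l -> bool}) : cpart k l :=
  CPart (part_of_rel_subproof c eP).

Lemma relpre_equivalence (S T : Type) (f : S -> T) (e : rel T) :
  equivalence_rel e -> equivalence_rel (relpre f e).
Proof. by move=> eP x y z; apply: eP. Qed.

(* The partition whose points [x], [y] are linked when [f x], [f y] are. *)
Definition relabel k l k' l' (f : pt k' l' -> pt k l) (p : cpart k l)
    (c : {ffun pt k' l' -> bool}) : cpart k' l' :=
  part_of_rel (relpre_equivalence f (linked_equivalence p)) c.

Lemma true_equivalence (T : Type) : equivalence_rel (fun _ _ : T => true).
Proof. by []. Qed.

Definition white_id : cpart 1 1 :=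
  part_of_rel (@true_equivalence (pt 1 1)) [ffun=> false].

Definition flip k l (x : pt l k) : pt k l :=
  match x with inl i => inr i | inr j => inl j end.

Definition adj k l (p : cpart k l) : cpart l k :=
  relabel (@flip k l) p [ffun x => color p (flip x)].

Definition split_pt k k' l l' (x : pt (k + k') (l + l')) : pt k l + pt k' l' :=
  match x with
  | inl i => match split i with inl a => inl (inl a) | inr b => inr (inl b) end
  | inr j => match split j with inl a => inl (inr a) | inr b => inr (inr b) end
  end.

Definition sum_rel (S T : Type) (e : rel S) (f : rel T) : rel (S + T) :=
  fun x y => match x, y with
    | inl a, inl b => e a b | inr a, inr b => f a b | _, _ => false end.

Lemma sum_rel_equivalence (S T : Type) (e : rel S) (f : rel T) :
  equivalence_rel e -> equivalence_rel f -> equivalence_rel (sum_rel e f).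
Proof.
move=> eP fP [x|x] [y|y] [z|z] /=; split=> //;
  first [exact: (eP z z z).1 | exact: (fP z z z).1
        | exact: (eP x y z).1 | exact: (fP x y z).1
        | exact: (eP x y z).2 | exact: (fP x y z).2].
Qed.

Definition tensor k k' l l' (p : cpart k l) (q : cpart k' l') :
    cpart (k + k') (l + l') :=
  part_of_rel
    (relpre_equivalence (@split_pt k k' l l')
       (sum_rel_equivalence (linked_equivalence p) (linked_equivalence q)))
    [ffun x => match split_pt x with inl a => color p a | inr b => color q b end].

(* Composition goes through three rows of points. *)
Definition rows3 (k l m : nat) : finType := (pt k l + 'I_m)%type.

Definition in_top k l m (x : rows3 k l m) : option (pt k l) :=
  if x is inl y then Some y else None.

Definition in_bottom k l m (x : rows3 k l m) : option (pt l m) :=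
  match x with
  | inl (inl _) => None
  | inl (inr j) => Some (inl j)
  | inr j => Some (inr j)
  end.

Definition outer k l m (x : pt k m) : rows3 k l m :=
  match x with inl i => inl (inl i) | inr j => inr j end.

Definition opt_rel (T : Type) (e : rel T) : rel (option T) :=
  fun x y => if x is Some a then if y is Some b then e a b else false else false.

Definition stacked k l m (q : cpart l m) (p : cpart k l) : rel (rows3 k l m) :=
  fun x y => opt_rel (linked p) (in_top x) (in_top y)
          || opt_rel (linked q) (in_bottom x) (in_bottom y).

Lemma opt_rel_sym (T : Type) (e : rel T) :
  equivalence_rel e -> symmetric (opt_rel e).
Proof.
by move=> /equivalence_relP [er et] [a|] [b|] //=; apply/idP/idP => ab;
   [rewrite -(et _ _ ab) er | rewrite -(et _ _ ab) er].
Qed.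

Lemma connect_stacked_equivalence k l m (q : cpart l m) (p : cpart k l) :
  equivalence_rel (connect (stacked q p)).
Proof.
have symc : connect_sym (stacked q p).
  apply: sym_connect_sym => x y; rewrite /stacked.
  congr orb; first exact: (opt_rel_sym (linked_equivalence p)).
  exact: (opt_rel_sym (linked_equivalence q)).
apply/equivalence_relP; split=> [x | x y xy z]; first exact: connect0.
exact: (same_connect symc).
Qed.

(* [comp q p] is the composition $qp$, with [p] on top; only meaningful when
   [lcol p = ucol q]. *)
Definition comp k l m (q : cpart l m) (p : cpart k l) : cpart k m :=
  part_of_rel (relpre_equivalence (@outer k l m) (connect_stacked_equivalence q p))
    [ffun x => match x with inl i => color p (inl i) | inr j => color q (inr j) end].

(* The leftmost ([right = false]) or rightmost ([right = true]) place of a row. *)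
Definition end_ord (right : bool) (n : nat) : 'I_n.+1 :=
  if right then ord_max else ord0.

Definition unrot_down right k l (x : pt k l.+1) : pt k.+1 l :=
  match x with
  | inl i => inl (lift (end_ord right k) i)
  | inr j => if unlift (end_ord right l) j is Some j' then inr j'
             else inl (end_ord right k)
  end.

Definition rot_down right k l (p : cpart k.+1 l) : cpart k l.+1 :=
  relabel (@unrot_down right k l) p
    [ffun x => color p (unrot_down right x) (+) (x == inr (end_ord right l))].

Definition unrot_up right k l (x : pt k.+1 l) : pt k l.+1 :=
  match x with
  | inl i => if unlift (end_ord right k) i is Some i' then inl i'
             else inr (end_ord right l)
  | inr j => inr (lift (end_ord right l) j)
  end.

Definition rot_up right k l (p : cpart k l.+1) : cpart k.+1 l :=
  relabel (@unrot_up right k l) p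
    [ffun x => color p (unrot_up right x) (+) (x == inl (end_ord right k))].

Record category (C : forall k l, {set cpart k l}) : Prop := Category {
  cat_id : white_id \in C 1 1;
  cat_tensor : forall k k' l l' (p : cpart k l) (q : cpart k' l'),
    p \in C k l -> q \in C k' l' -> tensor p q \in C (k + k')%N (l + l')%N;
  cat_adj : forall k l (p : cpart k l), p \in C k l -> adj p \in C l k;
  cat_comp : forall k l m (q : cpart l m) (p : cpart k l),
    q \in C l m -> p \in C k l -> lcol p = ucol q -> comp q p \in C k m;
  cat_rot_down : forall right k l (p : cpart k.+1 l),
    p \in C k.+1 l -> rot_down right p \in C k l.+1;
  cat_rot_up : forall right k l (p : cpart k l.+1),
    p \in C k l.+1 -> rot_up right p \in C k.+1 l }.

Definition through k l (B : {set pt k l}) : bool :=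
  [exists i, inl i \in B] && [exists j, inr j \in B].

(* [nthrough p] is $t(p)$ and [nother p] is $\beta(p)$. *)
Definition nthrough k l (p : cpart k l) : nat :=
  #|[set B in blocks p | through B]|.

Definition nother k l (p : cpart k l) : nat :=
  #|[set B in blocks p | ~~ through B]|.

(* [adj p == p] makes the two colorings of [p] agree, so that $pp$ is defined. *)
Definition projective k (p : cpart k k) : bool :=
  (comp p p == p) && (adj p == p).

Definition preceq k (q p : cpart k k) : bool :=
  (ucol q == ucol p) && (comp p q == q).

Definition prec k (q p : cpart k k) : bool := preceq q p && (q != p).

Definition X (C : forall k l, {set cpart k l}) k l (p : cpart k k) (q : cpart l l) :
    {set cpart (k + l) (k + l)} :=
  [set m in C (k + l)%N (k + l)%N | [&& projective m, preceq m (tensor p q),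
     [forall p' in C k k, projective p' && prec p' p ==>
        ~~ preceq m (tensor p' q)] &
     [forall q' in C l l, projective q' && prec q' q ==>
        ~~ preceq m (tensor p q')]]].

Definition is_minup k l (s : cpart k l) (c : 'I_l) (i : 'I_k) : bool :=
  linked s (inr c) (inl i) &&
  [forall j : 'I_k, linked s (inr c) (inl j) ==> (i <= j)%N].

Definition building k l (s : cpart k l) : bool :=
  [&& lcol s == [ffun=> false],
      [forall c : 'I_l, forall d : 'I_l, linked s (inr c) (inr d) ==> (c == d)],
      [forall c : 'I_l, exists i : 'I_k, linked s (inr c) (inl i)] &
      [forall c : 'I_l, forall d : 'I_l, forall i : 'I_k, forall j : 'I_k,
         [&& (c < d)%N, is_minup s c i & is_minup s d j] ==> (i < j)%N]].

Definition is_upart k (p : cpart k k) (s : cpart k (nthrough p)) : bool :=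
  building s && (comp (adj s) s == p).

Definition mixing_block k l (B : {set pt (k + l) (k + l)}) : bool :=
  [|| [exists x : 'I_(k + l), B == [set inl x; inr x]],
      [exists a : 'I_k, exists b : 'I_l,
         B == [set inl (lshift l a); inl (rshift k b)]],
      [exists a : 'I_k, exists b : 'I_l,
         B == [set inr (lshift l a); inr (rshift k b)]] |
      [exists a : 'I_k, exists b : 'I_l,
         B == [set inl (lshift l a); inr (lshift l a);
                   inl (rshift k b); inr (rshift k b)]]].

Definition mixing k l (h : cpart (k + l) (k + l)) : bool :=
  [&& projective h, color h == [ffun=> false] &
      [forall B in blocks h, mixing_block B]].

Definition Y k l (p : cpart k k) (q : cpart l l) : {set cpart (k + l) (k + l)} :=
  [set m | [exists pu : cpart k (nthrough p), exists qu : cpart l (nthrough q),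
    exists h : cpart (nthrough p + nthrough q) (nthrough p + nthrough q),
    [&& is_upart pu, is_upart qu, mixing h &
        m == comp (tensor (adj pu) (adj qu)) (comp h (tensor pu qu))]]].

From mathcomp Require Import complex.
From mathcomp Require Import all_classical all_reals.

Import Order.TTheory GRing.Theory Num.Theory.

Local Open Scope ring_scope.

Section Operators.
Variable R : realType.
Local Notation C := R[i].

Definition fspace (I : finType) := {ffun I -> C^o}.

Definition basis (I : finType) (i : I) : fspace I := [ffun j => (i == j)%:R].

Definition coef (I J : finType) (T : 'Hom(fspace I, fspace J)) (j : J) (i : I) : C :=
  T (basis i) j.

(* The linear map $e_i \mapsto \sum_j a_{ji} e_j$. *)
Definition op (I J : finType) (a : J -> I -> C) : 'Hom(fspace I, fspace J) :=
  linfun (fun v : fspace I => [ffun j => \sum_i a j i * v i] : fspace J).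

Definition adjop (I J : finType) (T : 'Hom(fspace I, fspace J)) :
    'Hom(fspace J, fspace I) :=
  op (fun i j => (coef T j i)^*).

Definition is_proj (I : finType) (P : 'End(fspace I)) : Prop :=
  (P \o P)%VF = P /\ adjop P = P.

Definition le_proj (I : finType) (P Q : 'End(fspace I)) : Prop :=
  (Q \o P)%VF = P.

Definition is_sup_proj (I : finType) (H S : set 'End(fspace I))
    (Q : 'End(fspace I)) : Prop :=
  [/\ H Q, is_proj Q, (forall T, S T -> le_proj T Q) &
      forall Q', H Q' -> is_proj Q' -> (forall T, S T -> le_proj T Q') ->
        le_proj Q Q'].

(* The supremum of [S] among the projections of [H] (it is [0] if [S] is empty). *)
Definition sup_proj (I : finType) (H S : set 'End(fspace I)) : 'End(fspace I) :=
  xget 0 [set Q | is_sup_proj H S Q].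

Variable N : nat.

(* Multi-indices: the canonical basis of the $k$-th tensor power of $C^N$. *)
Definition midx (k : nat) : finType := {ffun 'I_k -> 'I_N}.

Definition lidx k l (i : midx (k + l)) : midx k := [ffun a => i (lshift l a)].
Definition ridx k l (i : midx (k + l)) : midx l := [ffun b => i (rshift k b)].

Definition delta k l (p : cpart k l) (i : midx k) (j : midx l) : bool :=
  let lab (x : pt k l) := match x with inl a => i a | inr b => j b end in
  [forall x, forall y, linked p x y ==> (lab x == lab y)].

Definition Tmap k l (p : cpart k l) : 'Hom(fspace (midx k), fspace (midx l)) :=
  (sqrtC N%:R) ^- nother p *: op (fun j i => (delta p i j)%:R).

Definition tensor_op k l (S : 'End(fspace (midx k))) (T : 'End(fspace (midx l))) :
    'End(fspace (midx (k + l))) :=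
  op (fun j i => coef S (lidx j) (lidx i) * coef T (ridx j) (ridx i)).

End Operators.

(* Unital C*-algebras; [algType] makes them nonzero. Nonnegativity of [cnorm]
   and isometry of [star] follow from the axioms. *)
Record cstarAlg (R : realType) := CStarAlg {
  calg :> algType R[i];
  star : calg -> calg;
  cnorm : calg -> R;
  starK : forall x, star (star x) = x;
  starD : forall x y, star (x + y) = star x + star y;
  starZ : forall (a : R[i]) x, star (a *: x) = a^* *: star x;
  starM : forall x y, star (x * y) = star y * star x;
  cnorm_eq0 : forall x, cnorm x = 0 -> x = 0;
  cnormZ : forall (a : R[i]) x, cnorm (a *: x) = Normc.normc a * cnorm x;
  cnormD : forall x y, cnorm (x + y) <= cnorm x + cnorm y;
  cnormM : forall x y, cnorm (x * y) <= cnorm x * cnorm y;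
  cnorm_star : forall x, cnorm (star x * x) = cnorm x ^+ 2;
  cnorm_complete : forall f : nat -> calg,
    (forall e : R, 0 < e -> exists n0 : nat, forall m n : nat,
       (n0 <= m)%N -> (n0 <= n)%N -> cnorm (f m - f n) < e) ->
    exists x, forall e : R, 0 < e -> exists n0 : nat, forall n : nat,
       (n0 <= n)%N -> cnorm (f n - x) < e }.

Section CStar.
Variable R : realType.
Local Notation C := R[i].

Definition norm_dense (A : cstarAlg R) (S : set A) : Prop :=
  forall (x : A) (e : R), 0 < e -> exists2 y, S y & cnorm (x - y) < e.

Definition star_morph (A B : cstarAlg R) (f : A -> B) : Prop :=
  forall x, f (star x) = star (f x).

(* [B], with [f] and [g], is a C*-completion of the algebraic tensor product of
   [A1] and [A2]: $a \otimes b \mapsto f(a)g(b)$ is an injective *-homomorphism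
   of the algebraic tensor product, with dense range. *)
Record is_cstar_tensor (A1 A2 B : cstarAlg R)
    (f : {lrmorphism A1 -> B}) (g : {lrmorphism A2 -> B}) : Prop := {
  tensor_starl : star_morph f;
  tensor_starr : star_morph g;
  tensor_comm : forall a b, f a * g b = g b * f a;
  tensor_inj : forall n (a : 'I_n -> A1) (b : 'I_n -> A2),
    (forall c : 'I_n -> C, \sum_i c i *: a i = 0 -> forall i, c i = 0) ->
    \sum_i f (a i) * g (b i) = 0 -> forall i, b i = 0;
  tensor_dense : norm_dense [set x | exists s : seq (A1 * A2),
    x = \sum_(ab <- s) f ab.1 * g ab.2] }.

(* Among all C*-completions, the minimal tensor product carries the smallest C*-norm. *)
Definition is_min_tensor (A1 A2 B : cstarAlg R)
    (f : {lrmorphism A1 -> B}) (g : {lrmorphism A2 -> B}) : Prop :=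
  is_cstar_tensor f g /\
  forall (B' : cstarAlg R) (f' : {lrmorphism A1 -> B'})
    (g' : {lrmorphism A2 -> B'}), is_cstar_tensor f' g' ->
  forall s : seq (A1 * A2),
    cnorm (\sum_(ab <- s) f ab.1 * g ab.2) <=
    cnorm (\sum_(ab <- s) f' ab.1 * g' ab.2).

Definition star_subalg (A : cstarAlg R) (S : set A) : Prop :=
  [/\ S 1, forall (c : C) x y, S x -> S y -> S (c *: x + y),
      forall x y, S x -> S y -> S (x * y) & forall x, S x -> S (star x)].

Definition star_mx (A : cstarAlg R) n (u : 'M[A]_n) : 'M[A]_n :=
  \matrix_(i, j) star (u j i).

Definition conj_mx (A : cstarAlg R) n (u : 'M[A]_n) : 'M[A]_n :=
  \matrix_(i, j) star (u i j).

Definition invertible_mx (A : cstarAlg R) n (u : 'M[A]_n) : Prop :=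
  exists v : 'M[A]_n, u *m v = 1%:M /\ v *m u = 1%:M.

(* A compact quantum group given with an [n]-dimensional fundamental
   representation, in the sense of Woronowicz; coassociativity of the
   comultiplication follows from its values on the coefficients of [fund]. *)
Record cmqg (n : nat) := CMQG {
  cqalg : cstarAlg R;
  cqalg2 : cstarAlg R;
  leg1 : {lrmorphism cqalg -> cqalg2};
  leg2 : {lrmorphism cqalg -> cqalg2};
  legsP : is_min_tensor leg1 leg2;
  comult : {lrmorphism cqalg -> cqalg2};
  comult_star : star_morph comult;
  fund : 'M[cqalg]_n;
  fund_comult : forall i j,
    comult (fund i j) = \sum_k leg1 (fund i k) * leg2 (fund k j);
  fund_unitary : fund *m star_mx fund = 1%:M /\ star_mx fund *m fund = 1%:M;
  fund_conj : invertible_mx (conj_mx fund);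
  fund_dense : norm_dense [set x | forall S : set cqalg,
    star_subalg S -> (forall i j, S (fund i j)) -> S x] }.

End CStar.

Section Representations.
Variables (R : realType) (A : cstarAlg R).
Local Notation C := R[i].

(* The matrices of $(\iota\otimes T)x$ and $x(\iota\otimes T)$. *)
Definition lact (I J K : finType) (T : 'Hom(fspace R J, fspace R I))
    (x : J -> K -> A) : I -> K -> A :=
  fun i k => \sum_j coef T i j *: x j k.

Definition ract (I J K : finType) (x : I -> J -> A)
    (T : 'Hom(fspace R K, fspace R J)) : I -> K -> A :=
  fun i k => \sum_j coef T j k *: x i j.

(* $\mathrm{Hom}(x,y)$: the $T$ with $(\iota\otimes T)x = y(\iota\otimes T)$. *)
Definition intertwiners (I J : finType) (x : I -> I -> A) (y : J -> J -> A) :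
    set 'Hom(fspace R I, fspace R J) :=
  [set T | lact T x = ract y T].

(* A representation on the range of the projection [rproj] of [fspace R I]; its
   matrix [rmat] is supported on that range. *)
Record rep (I : finType) := Rep {
  rproj : 'End(fspace R I);
  rmat : I -> I -> A }.

Definition restrict (I : finType) (P : 'End(fspace R I)) (x : I -> I -> A) : rep I :=
  Rep P (lact P x).

Definition subrep (I : finType) (v x : rep I) : Prop :=
  [/\ is_proj (rproj v), le_proj (rproj v) (rproj x),
      intertwiners (rmat x) (rmat x) (rproj v) &
      v = restrict (rproj v) (rmat x)].

Definition tensor_rep N k l (x : rep (midx N k)) (y : rep (midx N l)) :
    rep (midx N (k + l)) :=
  Rep (tensor_op (rproj x) (rproj y))
      (fun i j => rmat x (lidx i) (lidx j) * rmat y (ridx i) (ridx j)).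

(* $x = \sum_{m \in M} y_m$ : a subrepresentation of [x] containing all the
   summands is equal to [x]. *)
Definition is_sum (I J : finType) (x : rep I) (M : {set J}) (y : J -> rep I) : Prop :=
  forall v, subrep v x -> (forall m, m \in M -> subrep (y m) v) -> v = x.

(* [is_sum] alone says nothing when the range of some [y m] does not lie in the
   range of [x]; this does happen for the [urep] below (if the category contains
   all partitions and $p=q$ is the white identity, the invariant vector
   $\sum_i e_i\otimes e_i$ is not in the range of $P_p\otimes P_q$).
   [is_sum_proj] is the same property for summands whose ranges need not lie in the range of [x]: each of
   them is then replaced by its image under the projection onto the range of [x].
   When [subrep (y m) x], this image is the range of [y m], so [is_sum_proj]
   implies [is_sum]. *)
Definition is_sum_proj (I J : finType) (x : rep I) (M : {set J}) (y : J -> rep I) :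
    Prop :=
  forall v, subrep v x ->
    (forall m, m \in M ->
       (rproj v \o (rproj x \o rproj (y m)) = rproj x \o rproj (y m))%VF) ->
    v = x.

End Representations.

Section Easy.
Variables (R : realType) (N : nat) (C : forall k l, {set cpart k l}).
Variable (G : cmqg R N).

(* The matrix of $u^w$; [\prod] multiplies from left to right. *)
Definition upow k (w : word k) (i j : midx N k) : cqalg G :=
  \prod_(a < k) (if w a then conj_mx (fund G) (i a) (j a)
                 else fund G (i a) (j a)).

Definition is_easy : Prop :=
  forall k l (w : word k) (w' : word l)
    (T : 'Hom(fspace R (midx N k), fspace R (midx N l))),
  intertwiners (upow w) (upow w') T <->
  T \in <<[seq Tmap R N p | p in [set p in C k l |
             (ucol p == w) && (lcol p == w')]]>>%VS.

Definition Pproj k (p : cpart k k) : 'End(fspace R (midx N k)) :=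
  Tmap R N p -
  sup_proj (intertwiners (upow (ucol p)) (upow (ucol p)))
    [set T | exists q, [/\ q \in C k k, projective q, prec q p & T = Tmap R N q]].

Definition urep k (p : cpart k k) : rep (cqalg G) (midx N k) :=
  restrict (Pproj p) (upow (ucol p)).

End Easy.

(* Main.v *)
Require Import Defs.
From mathcomp Require Import all_boot all_order all_algebra.
From mathcomp Require Import all_classical all_reals.
From HB Require Import structures.
From mathcomp Require Import complex.

(** A projective partition is the same thing as an equivalence relation on one
row of points together with a set of classes, those of its through-blocks;
such a pair is called a [profile] below. For profiles, [preceq m p] says that
[m] is obtained from [p] by merging some through-blocks and by cutting some of
the resulting through-blocks in two ([refines], [preceqP]). So the [m] below
$p\otimes q$ correspond to the profiles on the $t(p)+t(q)$ through-blocks of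
$p\otimes q$, and $p\ast_hq$ is the one with profile $h$.

The equality of $X$ and $Y\cap C$ rests on partial traces. Let $m\preceq
p\otimes q$ in $C$, and join each upper point of the right half of $m$ to the
lower point below it. What remains on the left is a projective partition $l$ of
$C$, since it is made with rotations and one composition ([partial_trace]). It
satisfies $l\preceq p$ and $m\preceq l\otimes q$. Hence $m\in X$ forces $l=p$,
and $l=p$ says two things: no two through-blocks of $p$ are merged in $m$, and
each of them that is cut in $m$ was merged with a through-block of $q$. With the
same for $q$, this is exactly the condition that the profile of $m$ on the
through-blocks is mixing ([tight], [X_tight], [mixed_mixing]). Conversely this
condition leaves no room for $l\prec p$ with $m\preceq l\otimes q$
([tight_X]).

For the decomposition, $T_p$ is a projection, $T_m\le T_p$ when $m\preceq p$
and $T_{p\otimes q}=T_p\otimes T_q$ ([Tmap_proj], [Tmap_le], [Tmap_tensor]).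
Put $Q=P_p\otimes P_q$, and let $E=Q-V$ where $V\le Q$ is the projection of a
subrepresentation that contains the image under $Q$ of the range of each $P_m$,
$m\in X$. Then $EP_m=0$ for $m\in X$. If $m\preceq p\otimes q$ is not in $X$,
then $T_m\le T_l\otimes T_q$ with $l\prec p$, or symmetrically, so
$QP_m=0$ and again $EP_m=0$ ([Pproj_orth]). Since $T_m$ is $P_m$ plus the
supremum of the $T_n$, $n\prec m$, a projection of the intertwiner space that
kills all these $P_m$ kills all these $T_m$, by induction along $\prec$
([kill_Tmap]). In particular it kills $T_{p\otimes q}\ge Q\ge E$, so $E=0$.
The suprema do exist: the projection onto the sum of the ranges of self-adjoint
intertwiners is again an intertwiner ([sup_projP]). *)

Set Implicit Arguments.
Unset Strict Implicit.
Unset Printing Implicit Defensive.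

Local Notation comp := Defs.comp.
Local Notation split := fintype.split.
Local Notation pblock := finset.pblock.

(** * Blocks as equivalence relations *)

Section Linked.
Variables k l : nat.
Implicit Types p q : cpart k l.

Lemma linkedxx p : reflexive (linked p).
Proof. by move=> x; have /equivalence_relP[r _] := linked_equivalence p. Qed.

Lemma linkedC p : symmetric (linked p).
Proof.
have /equivalence_relP[r t] := linked_equivalence p => x y.
by apply/idP/idP => xy; [rewrite -(t _ _ xy) r | rewrite -(t _ _ xy) r].
Qed.

Lemma linked_trans p : transitive (linked p).
Proof.
have /equivalence_relP[r t] := linked_equivalence p => y x z xy yz.
by rewrite (t _ _ xy).
Qed.

Lemma linked_part_of_rel (e : rel (pt k l)) (eP : equivalence_rel e) c :
  linked (part_of_rel eP c) =2 e.
Proof.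
by move=> x y; rewrite /linked pblock_equivalence_partition ?inE // => *; apply: eP.
Qed.

Lemma cpart_ext p q : linked p =2 linked q -> color p =1 color q -> p = q.
Proof.
move=> epq cpq; apply: val_inj; rewrite /= [cpart_val p]surjective_pairing
  [cpart_val q]surjective_pairing; congr pair; last exact/ffunP.
rewrite -(equivalence_partition_pblock (cpartP p)).
rewrite -(equivalence_partition_pblock (cpartP q)).
by apply: eq_imset => x; apply/setP => y; rewrite !inE; exact: epq.
Qed.

End Linked.

(** * Profiles *)

(** The set [thru] of points in through-blocks is a union of classes. *)
Record profile (I : Type) := Profile {
  prel :> rel I;
  thru : pred I;
  prelP : equivalence_rel prel;
  thruP : forall x y, prel x y -> thru x = thru y }.

Section Profile.
Variable I : Type.
Implicit Types P Q : profile I.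

Lemma profxx P x : P x x.
Proof. exact: (prelP P x x x).1. Qed.

Lemma prof_eq P x y : P x y -> P x =1 P y.
Proof. by move=> xy z; exact: (prelP P x y z).2. Qed.

Lemma profC P x y : P x y = P y x.
Proof. by apply/idP/idP => xy; rewrite -(prof_eq xy) profxx. Qed.

Lemma prof_trans P : transitive P.
Proof. by move=> y x z xy; rewrite (prof_eq xy). Qed.

(** The order of projective partitions: [P'] merges only through-classes of [P],
and may cut classes, never join the two copies of a class that [P] keeps apart. *)
Definition refines P' P : Prop :=
  [/\ forall x y, P x y -> P' x y,
      forall x y, P' x y -> P x y || thru P x && thru P y &
      forall x, thru P' x -> thru P x].

Lemma refines_refl P : refines P P.
Proof. by split=> // x y ->. Qed.

Lemma refines_trans Q P P' : refines P' Q -> refines Q P -> refines P' P.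
Proof.
move=> [a1 a2 a3] [b1 b2 b3]; split=> [x y /b1 /a1 //|x y /a2|x /a3 /b3 //].
case/orP=> [/b2 //|/andP[/b3 -> /b3 ->]]; exact: orbT.
Qed.

Lemma refines_anti P Q : refines P Q -> refines Q P ->
  P =2 Q /\ thru P =1 thru Q.
Proof.
move=> [a1 _ a3] [b1 _ b3]; split=> [x y|x]; apply/idP/idP; auto.
Qed.

End Profile.

Program Definition pull (I J : Type) (f : J -> I) (P : profile I) : profile J :=
  @Profile J (relpre f P) (fun x => thru P (f x)) _ _.
Next Obligation. by move=> I J f P x y z; exact: prelP. Qed.
Next Obligation. by move=> I J f P x y; exact: thruP. Qed.

Section Encodes.
Variable I : Type.
Implicit Types P : profile I.

Definition label k l (a : 'I_k -> I) (b : 'I_l -> I) (u : pt k l) : I :=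
  match u with inl x => a x | inr y => b y end.

Definition lower k l (u : pt k l) : bool := if u is inr _ then true else false.

(** Copies of the points of [I], at several levels: a through-class links all its
copies, any other class links copies of one level only. *)
Definition level_rel (J : Type) (f : J -> I) (lev : J -> bool) P : rel J :=
  fun u v => P (f u) (f v) && (thru P (f u) || (lev u == lev v)).

Lemma level_rel_equivalence (J : Type) (f : J -> I) lev P :
  equivalence_rel (level_rel f lev P).
Proof.
apply/equivalence_relP; split=> [u|u v]; first by rewrite /level_rel profxx eqxx orbT.
move=> /andP[uv luv] w; rewrite /level_rel (prof_eq uv).
by rewrite (thruP uv) in luv *; case/orP: luv => [->|/eqP ->].
Qed.

(** The labels let one profile describe partitions with rows of different sizes:
$p$, its upper part $p_u$ (with one lower point per through-block) and the middle
partition $h$ of $p\ast_hq$ all have a profile on the points of $p$. *)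
Definition encodes P k l (a : 'I_k -> I) (b : 'I_l -> I) (p : cpart k l) : Prop :=
  linked p =2 level_rel (label a b) (@lower k l) P.

End Encodes.

Lemma encodes_eq_labels (I : Type) (P : profile I) k l (a a' : 'I_k -> I)
    (b b' : 'I_l -> I) (p : cpart k l) :
  a =1 a' -> b =1 b' -> encodes P a b p -> encodes P a' b' p.
Proof. by move=> aa bb Pp [x|x] [y|y]; rewrite Pp /level_rel /= ?aa ?bb. Qed.

Lemma linked_adj k l (p : cpart k l) u v : linked (adj p) u v = linked p (flip u) (flip v).
Proof. exact: linked_part_of_rel. Qed.

Lemma flipK k l : cancel (@flip k l) (@flip l k).
Proof. by case. Qed.

Lemma encodes_adj (I : Type) (P : profile I) k l (a : 'I_k -> I) (b : 'I_l -> I)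
    (p : cpart k l) : encodes P a b p -> encodes P b a (adj p).
Proof. by move=> Pp u v; rewrite linked_adj Pp; case: u v => u [] v. Qed.

Lemma encodes_adjE (I : Type) (P : profile I) k l (a : 'I_k -> I) (b : 'I_l -> I)
    (p : cpart k l) : encodes P b a (adj p) -> encodes P a b p.
Proof.
move=> Pp u v; rewrite -[u]flipK -[v]flipK -linked_adj Pp.
by case: u v => u [] v.
Qed.

Section UpperProfile.
Variables k l : nat.
Implicit Type p : cpart k l.

Definition upper_rel p : rel 'I_k := fun x y => linked p (inl x) (inl y).

Definition upper_thru p : pred 'I_k := fun x => [exists y, linked p (inl x) (inr y)].

Lemma upper_relP p : equivalence_rel (upper_rel p).
Proof. by move=> x y z; apply: linked_equivalence. Qed.

Lemma upper_thruP p x y : upper_rel p x y -> upper_thru p x = upper_thru p y.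
Proof.
move=> xy; apply/existsP/existsP => -[z xz]; exists z; last exact: linked_trans xz.
by apply: linked_trans xz; rewrite linkedC.
Qed.

Definition upper p : profile 'I_k := Profile (upper_relP p) (@upper_thruP p).

(** A lower point [c] can always be labelled by an upper point of its block, when
there is one; building partitions are of this kind. *)
Lemma encodes_upper p (r : 'I_l -> 'I_k) :
  (forall c, linked p (inr c) (inl (r c))) -> encodes (upper p) id r p.
Proof.
move=> rP; have rC c u : linked p (inl (r c)) u = linked p (inr c) u.
  apply/idP/idP => h; first exact: linked_trans h.
  by apply: linked_trans h; rewrite linkedC.
have rC' c u : linked p u (inl (r c)) = linked p u (inr c) by rewrite !(linkedC _ u) rC.
have tr c : upper_thru p (r c) by apply/existsP; exists c; rewrite linkedC.
have td x c : linked p (inl x) (inr c) -> upper_thru p x.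
  by move=> h; apply/existsP; exists c.
case=> [x|c] [y|d]; rewrite /level_rel /= /upper_rel ?rC ?rC' ?orbT ?andbT ?tr ?andbT //.
by rewrite orbF; case: (boolP (linked _ _ _)) => // /td ->.
Qed.

Lemma encodes_upperE I (P : profile I) a b p : encodes P a b p ->
  (forall x y, upper p x y = P (a x) (a y)) /\
  (forall x, thru (upper p) x = [exists c, P (a x) (b c) && thru P (a x)]).
Proof.
move=> Pp; split=> [x y|x]; first by rewrite /= /upper_rel Pp /level_rel /= eqxx orbT andbT.
by apply: eq_existsb => c; rewrite Pp /level_rel /= orbF.
Qed.

End UpperProfile.

Lemma encodes_id_upper k (P : profile 'I_k) (p : cpart k k) : encodes P id id p ->
  P =2 upper p /\ thru P =1 thru (upper p).
Proof.
move=> /encodes_upperE[h1 h2]; split=> [x y|x]; rewrite ?h1 // h2.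
by apply/idP/existsP => [tx|[y /andP[]//]]; exists x; rewrite profxx.
Qed.

(** * Composition of partitions with a profile *)

Lemma stacked_sym k l m (q : cpart l m) (p : cpart k l) : connect_sym (stacked q p).
Proof.
move=> u v; have /equivalence_relP[r t] := connect_stacked_equivalence q p.
by apply/idP/idP => h; rewrite -(t _ _ h) r.
Qed.

Section Comp.
Variable I : Type.
Implicit Types P Q : profile I.

Lemma connect_stacked_sub k l m (q : cpart l m) (p : cpart k l)
    (R : rel (rows3 k l m)) :
  equivalence_rel R -> subrel (stacked q p) R -> subrel (connect (stacked q p)) R.
Proof.
move=> /equivalence_relP[r t] sub u v /connectP[s us ->] {v}.
elim: s u us => [u _|w s IH u /= /andP[uw ws]]; first exact: r.
by rewrite (t _ _ (sub _ _ uw)) IH.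
Qed.

Definition label3 k l m (a : 'I_k -> I) (b : 'I_l -> I) (c : 'I_m -> I)
    (u : rows3 k l m) : I :=
  match u with inl v => label a b v | inr y => c y end.

Definition level3 k l m (u : rows3 k l m) : bool :=
  if u is inl (inl _) then false else true.

Lemma stacked_top k l m (q : cpart l m) (p : cpart k l) x y :
  linked p x y -> stacked q p (inl x) (inl y).
Proof. by rewrite /stacked /= => ->. Qed.

Definition bottom_row k l m (x : pt l m) : rows3 k l m :=
  match x with inl y => inl (inr y) | inr y => inr y end.

Lemma stacked_bottom k l m (q : cpart l m) (p : cpart k l) x y :
  linked q x y -> stacked q p (bottom_row k x) (bottom_row k y).
Proof. by case: x y => x [] y; rewrite /stacked /= => ->; rewrite ?orbT. Qed.

Lemma stackedP k l m (q : cpart l m) (p : cpart k l) (R : rel (rows3 k l m)) :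
  (forall x y, linked p x y -> R (inl x) (inl y)) ->
  (forall x y, linked q x y -> R (bottom_row k x) (bottom_row k y)) ->
  subrel (stacked q p) R.
Proof.
move=> h1 h2 [[x|x]|x] [[y|y]|y]; rewrite /stacked /= ?orbF //;
  try exact: h1; try exact: (h2 (inl _) (inl _)); try exact: (h2 (inl _) (inr _));
  try exact: (h2 (inr _) (inl _)); try exact: (h2 (inr _) (inr _)).
by case/orP; [exact: h1 | exact: (h2 (inl _) (inl _))].
Qed.

Lemma linked_comp k l m (q : cpart l m) (p : cpart k l) u v :
  linked (comp q p) u v = connect (stacked q p) (outer l u) (outer l v).
Proof. by rewrite /comp linked_part_of_rel. Qed.

Variables (k l m : nat) (a : 'I_k -> I) (b : 'I_l -> I) (c : 'I_m -> I).

(** When [refines P' P], the profile [P] acts as an identity on [P']: the middle and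
bottom rows lie at one level of [P'], and a class of [P'] is a class of [P] or
consists of through-classes of [P], which carry it from one row to the other.
The surjectivity hypothesis gives the middle row a point on each through-class
of [P]. *)
Lemma encodes_comp_top P' P (p : cpart k l) (q : cpart l m) :
  refines P' P -> (forall y, thru P y -> exists j, P y (b j)) ->
  encodes P' a b p -> encodes P b c q -> encodes P' a c (comp q p).
Proof.
move=> [r1 r2 r3] surj Pp Pq.
have bot x y : thru P (c y) -> P' x (c y) ->
    exists2 j, P' x (b j) & connect (stacked q p) (inl (inr j)) (inr y).
  move=> ty xy; have [j yj] := surj _ ty; exists j.
    exact: prof_trans xy (r1 _ _ yj).
  apply/connect1/(@stacked_bottom k _ _ q p (inl j) (inr y)); rewrite Pq /level_rel /=.
  by rewrite profC yj -(thruP yj) ty.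
have top x y : P' (a x) (c y) -> thru P' (a x) ->
    connect (stacked q p) (inl (inl x)) (inr y).
  move=> xy tx; have ty : thru P (c y) by apply: r3; rewrite -(thruP xy).
  have [j xj jy] := bot _ _ ty xy; apply: connect_trans jy.
  by apply/connect1/stacked_top; rewrite Pp /level_rel /= xj tx.
move=> u v; rewrite linked_comp; apply/idP/idP => [h|].
  suff: level_rel (label3 a b c) (@level3 k l m) P' (outer l u) (outer l v).
    by case: u v {h} => u [] v.
  apply: connect_stacked_sub h; first exact: level_rel_equivalence.
  apply: stackedP => [x y|x y]; first by rewrite Pp; case: x y => x [] y.
  rewrite Pq => /andP[/r1 xy _]; case: x y xy => x [] y /= xy;
    by rewrite /level_rel /= xy orbT.
case: u v => x [] y; rewrite /level_rel /= ?orbT ?orbF ?andbT.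
- by move=> xy; apply/connect1/stacked_top; rewrite Pp /level_rel /= xy orbT.
- by case/andP=> *; apply: top.
- by case/andP=> xy tx; rewrite stacked_sym; apply: top; rewrite ?(thruP xy) // 1?profC // -(thruP xy).
move=> xy; case/orP: (r2 _ _ xy) => [h|/andP[tx ty]].
  by apply/connect1/(@stacked_bottom k _ _ q p (inr x) (inr y)); rewrite Pq /level_rel /= h orbT.
have [j xj jx] := bot _ _ tx (profxx P' (c x)).
have [i yi iy] := bot _ _ ty (profxx P' (c y)).
rewrite stacked_sym in jx; apply: connect_trans jx (connect_trans _ iy).
apply/connect1/stacked_top; rewrite Pp /level_rel /= orbT andbT.
by rewrite profC in xj; apply: prof_trans xj (prof_trans xy yi).
Qed.

End Comp.

Section CompMirror.

Definition mirror k l m (u : rows3 k l m) : rows3 m l k :=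
  match u with
  | inl (inl x) => inr x
  | inl (inr y) => inl (inr y)
  | inr z => inl (inl z)
  end.

Lemma mirrorK k l m : cancel (@mirror k l m) (@mirror m l k).
Proof. by case=> [[]|]. Qed.

Lemma stacked_mirror k l m (q : cpart l m) (p : cpart k l) u v :
  stacked (adj p) (adj q) (mirror u) (mirror v) = stacked q p u v.
Proof.
by case: u v => [[x|x]|x] [[y|y]|y]; rewrite /stacked /= ?linked_adj /= ?orbF // orbC.
Qed.

Lemma connect_homo (S S' : finType) (e : rel S) (e' : rel S') (f : S -> S') x y :
  (forall u v, e u v -> e' (f u) (f v)) -> connect e x y -> connect e' (f x) (f y).
Proof.
move=> h /connectP[s]; elim: s x => [x _ -> //|z s IH x /= /andP[xz zs] ey].
exact: connect_trans (connect1 (h _ _ xz)) (IH _ zs ey).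
Qed.

(** $(qp)^*=p^*q^*$, on blocks; it turns [encodes_comp_top] upside down. *)
Lemma linked_comp_adj k l m (q : cpart l m) (p : cpart k l) :
  linked (comp (adj p) (adj q)) =2 linked (adj (comp q p)).
Proof.
move=> u v; rewrite linked_adj !linked_comp.
have fE (w : pt m k) : outer l w = mirror (outer l (flip w)) by case: w.
rewrite 2!fE; apply/idP/idP => h; last first.
  by apply: connect_homo h => w w'; rewrite stacked_mirror.
rewrite -[outer _ (flip u)]mirrorK -[outer _ (flip v)]mirrorK.
apply: connect_homo h => w w'; rewrite -{1}[w]mirrorK -{1}[w']mirrorK.
by rewrite stacked_mirror.
Qed.

Lemma encodes_comp_bot (I : Type) (P' P : profile I) k l m (a : 'I_k -> I) (b : 'I_l -> I)
    (c : 'I_m -> I) (p : cpart k l) (q : cpart l m) :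
  refines P' P -> (forall y, thru P y -> exists j, P y (b j)) ->
  encodes P a b p -> encodes P' b c q -> encodes P' a c (comp q p).
Proof.
move=> r surj Pp Pq; apply: encodes_adjE => u v; rewrite -linked_comp_adj.
exact: (encodes_comp_top r surj (encodes_adj Pq) (encodes_adj Pp)).
Qed.

End CompMirror.

(** * Projective partitions and their order *)

Section Projective.
Variable k : nat.
Implicit Types p m : cpart k k.

Definition balanced p := forall x, color p (inl x) = color p (inr x).

Lemma adj_eqP p : adj p = p -> balanced p /\
  forall u v, linked p u v = linked p (flip u) (flip v).
Proof.
move=> ap; split=> [x|u v].
  by rewrite -{1}ap /adj /color /= ffunE.
by rewrite -{1}ap /adj /relabel linked_part_of_rel.
Qed.

(** From $p=p^*$ both rows carry the same relation. If an upper $x$ is linked to a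
lower $y$, then in $pp$ the path $x$, $y$, $x$ through the middle row links the two
copies of $x$; this is where $pp=p$ enters, and it makes a block through exactly
when it contains both copies of each of its points. *)
Lemma projective_encodes p : projective p -> encodes (upper p) id id p /\ balanced p.
Proof.
case/andP=> /eqP pp /eqP /adj_eqP[bp fp]; split=> //.
have thr x y : linked p (inl x) (inr y) -> linked p (inl x) (inr x).
  move=> xy; rewrite -pp linked_comp.
  apply: (@connect_trans _ _ (inl (inr y))).
    exact/connect1/stacked_top.
  apply/connect1/(@stacked_bottom k _ _ p p (inl y) (inr x)).
  by rewrite fp linkedC.
have thr2 x : upper_thru p x = linked p (inl x) (inr x).
  by apply/existsP/idP => [[y /thr //]|h]; exists x.
have lu x y : linked p (inl x) (inr y) = upper_rel p x y && upper_thru p x.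
  rewrite thr2; apply/idP/andP => [xy|[xy xx]]; last first.
    by apply: (linked_trans xx); rewrite fp.
  split; last exact: thr xy.
  rewrite /upper_rel fp; apply: linked_trans (xy); rewrite linkedC; exact: thr xy.
case=> x [] y; rewrite /level_rel /= ?orbT ?andbT ?orbF //.
  rewrite linkedC lu (_ : upper_rel p y x = upper_rel p x y); last exact: linkedC.
  by case: (boolP (upper_rel p x y)) => // /upper_thruP ->.
Qed.

Lemma encodes_adj_eq (P : profile 'I_k) p :
  encodes P id id p -> balanced p -> adj p = p.
Proof.
move=> Pp bp; apply: cpart_ext.
  by move=> u v; rewrite (encodes_adj Pp) Pp.
by case=> x; rewrite /adj /color /= ffunE /= -/(color p) bp.
Qed.

Lemma color_comp j l n (q : cpart l n) (p : cpart j l) u : color (comp q p) u =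
  match u with inl i => color p (inl i) | inr i => color q (inr i) end.
Proof. by rewrite /comp /color /= ffunE. Qed.

(** That $pm=m$ implies [refines] is seen on the bottom row of [stacked p m]: the
links of [p] there must already be in [m], and outside the through-classes of
[p] no path leaves that row, so that the classes of [m] are those of [p] there
and are not through. *)
Lemma compP_refines (P P' : profile 'I_k) p m :
    encodes P id id p -> encodes P' id id m -> balanced m -> balanced p ->
    ucol m = ucol p ->
  comp p m = m <-> refines P' P.
Proof.
move=> Pp Pm bm bp upm; split=> [cm|r]; last first.
  have Pc : encodes P' id id (comp p m).
    by apply: encodes_comp_top Pm Pp => // y _; exists y; exact: profxx.
  apply: cpart_ext => [u v|[x|x]]; rewrite ?color_comp ?Pc ?Pm //.
  by rewrite -bm -bp; have /ffunP/(_ x) := upm; rewrite !ffunE.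
have closed_bot x : ~~ thru P x -> forall v, connect (stacked p m) (inr x) v ->
    if v is inr y then P x y else false.
  move=> ntx v; pose D (w : rows3 k k k) := if w is inr y then P x y else false.
  have dx : D (inr x) by exact: profxx.
  case/connectP=> s; elim: s (inr x : rows3 k k k) dx => [w dw _ ->|w s IH w' dw] //.
  case/andP=> ww /IH{}IH /IH; apply.
  case: w' dw ww => //= y xy; rewrite /stacked /=; case: w IH => [[z|z]|z] _ //=.
    by rewrite Pp /level_rel /= orbF -(thruP xy) (negPf ntx) andbF.
  by rewrite Pp => /andP[yz _]; apply: prof_trans xy yz.
split=> [x y xy|x y xy|x tx].
- have : linked (comp p m) (inr x) (inr y).
    rewrite linked_comp; apply/connect1/(@stacked_bottom k _ _ p m (inr x) (inr y)).
    by rewrite Pp /level_rel /= xy orbT.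
  by rewrite cm Pm => /andP[].
- have half a b : P' a b -> ~~ thru P a -> P a b.
    move=> ab na; have: linked (comp p m) (inr a) (inr b).
      by rewrite cm Pm /level_rel /= ab orbT.
    by rewrite linked_comp => /(closed_bot _ na).
  case: (boolP (thru P x)) => [tx|/(half _ _ xy) -> //].
  case: (boolP (thru P y)) => [ty|nt]; first by rewrite orbT.
  by rewrite profC half // profC.
- apply/negPn/negP => /closed_bot h.
  have: linked (comp p m) (inr x) (inl x) by rewrite cm Pm /level_rel /= profxx tx.
  by rewrite linked_comp => /h.
Qed.

Lemma encodes_projective (P : profile 'I_k) p :
  encodes P id id p -> balanced p -> projective p.
Proof.
move=> Pp bp; rewrite /projective (encodes_adj_eq Pp bp) eqxx andbT.
by apply/eqP/(compP_refines Pp Pp bp bp erefl)/refines_refl.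
Qed.

Lemma preceqP (P P' : profile 'I_k) p m :
    encodes P id id p -> encodes P' id id m -> balanced m -> balanced p ->
  reflect (ucol m = ucol p /\ refines P' P) (preceq m p).
Proof.
move=> Pp Pm bm bp; apply: (iffP andP) => -[].
  by move=> /eqP e /eqP/(compP_refines Pp Pm bm bp e).
by move=> e /(compP_refines Pp Pm bm bp e) ->; rewrite e !eqxx.
Qed.

Lemma eq_ucol p m : balanced p -> balanced m -> ucol m = ucol p -> color m =1 color p.
Proof.
move=> bp bm /ffunP h [x|x]; have := h x; rewrite !ffunE //.
by rewrite bp bm.
Qed.

End Projective.

(** * Tensor products *)

Section Tensor.

(** Case distinction on which of the two halves a point belongs to. *)
Definition side k l (T : Type) (a : 'I_k -> T) (b : 'I_l -> T) (i : 'I_(k + l)) : T :=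
  match split i with inl x => a x | inr y => b y end.

Lemma side_l k l T (a : 'I_k -> T) (b : 'I_l -> T) x : side a b (lshift l x) = a x.
Proof. by rewrite /side (unsplitK (inl x : 'I_k + 'I_l)%type). Qed.

Lemma side_r k l T (a : 'I_k -> T) (b : 'I_l -> T) x : side a b (rshift k x) = b x.
Proof. by rewrite /side (unsplitK (inr x : 'I_k + 'I_l)%type). Qed.

Lemma side_ind k l (S : 'I_(k + l) -> Prop) :
  (forall x, S (lshift l x)) -> (forall y, S (rshift k y)) -> forall i, S i.
Proof. by move=> hl hr i; case: (split_ordP i) => j ->. Qed.

Definition cat_map k l k' l' (a : 'I_k -> 'I_k') (b : 'I_l -> 'I_l') : 'I_(k + l) -> 'I_(k' + l') :=
  side (fun x => lshift l' (a x)) (fun y => rshift k' (b y)).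

Lemma cat_map_id k l : @cat_map k l k l id id =1 id.
Proof. by elim/side_ind => x; rewrite /cat_map ?side_l ?side_r. Qed.

Definition cat_rel k l (P : rel 'I_k) (Q : rel 'I_l) : rel 'I_(k + l) :=
  fun i j => sum_rel P Q (split i) (split j).

Definition cat_thru k l (P : pred 'I_k) (Q : pred 'I_l) : pred 'I_(k + l) := side P Q.

Lemma cat_relP k l (P : profile 'I_k) (Q : profile 'I_l) : equivalence_rel (cat_rel P Q).
Proof.
by apply: (relpre_equivalence _ (sum_rel_equivalence (prelP P) (prelP Q))).
Qed.

Lemma cat_thruP k l (P : profile 'I_k) (Q : profile 'I_l) i j :
  cat_rel P Q i j -> cat_thru (thru P) (thru Q) i = cat_thru (thru P) (thru Q) j.
Proof.
rewrite /cat_rel /cat_thru /side; case: (split i) => a; case: (split j) => b //=;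
  exact: thruP.
Qed.

Definition cat_prof k l (P : profile 'I_k) (Q : profile 'I_l) : profile 'I_(k + l) :=
  Profile (cat_relP P Q) (@cat_thruP _ _ P Q).

Section CatProfE.
Variables (k l : nat) (P : profile 'I_k) (Q : profile 'I_l).
Local Notation PQ := (cat_prof P Q).

Lemma cat_ll x y : PQ (lshift l x) (lshift l y) = P x y.
Proof. by rewrite /= /cat_rel !(unsplitK (inl _ : 'I_k + 'I_l)%type). Qed.
Lemma cat_rr x y : PQ (rshift k x) (rshift k y) = Q x y.
Proof. by rewrite /= /cat_rel !(unsplitK (inr _ : 'I_k + 'I_l)%type). Qed.
Lemma cat_lr x y : PQ (lshift l x) (rshift k y) = false.
Proof.
by rewrite /= /cat_rel (unsplitK (inl _ : 'I_k + 'I_l)%type) (unsplitK (inr _ : 'I_k + 'I_l)%type).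
Qed.
Lemma cat_rl x y : PQ (rshift k x) (lshift l y) = false.
Proof. by rewrite profC cat_lr. Qed.
Lemma cat_tl x : thru PQ (lshift l x) = thru P x. Proof. exact: side_l. Qed.
Lemma cat_tr x : thru PQ (rshift k x) = thru Q x. Proof. exact: side_r. Qed.
Definition catE := (cat_ll, cat_rr, cat_lr, cat_rl, cat_tl, cat_tr).
End CatProfE.

Lemma encodes_tensor n1 n2 k k' l l' (P : profile 'I_n1) (Q : profile 'I_n2)
    (a : 'I_k -> 'I_n1) (b : 'I_l -> 'I_n1) (a' : 'I_k' -> 'I_n2) (b' : 'I_l' -> 'I_n2)
    (p : cpart k l) (q : cpart k' l') :
  encodes P a b p -> encodes Q a' b' q ->
  encodes (cat_prof P Q) (cat_map a a') (cat_map b b') (tensor p q).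
Proof.
move=> Pp Qq u v; rewrite /tensor linked_part_of_rel /=.
case: u v => u [] v; elim/side_ind: u => u; elim/side_ind: v => v;
rewrite /level_rel /label /cat_map ?side_l ?side_r ?catE /split_pt
  ?(unsplitK (inl _ : 'I__ + 'I__)%type) ?(unsplitK (inr _ : 'I__ + 'I__)%type) //= ?Pp ?Qq //.
Qed.

Lemma encodes_tensor_id k l (P : profile 'I_k) (Q : profile 'I_l) p q :
  encodes P id id p -> encodes Q id id q -> encodes (cat_prof P Q) id id (tensor p q).
Proof.
move=> Pp Qq; apply: encodes_eq_labels (encodes_tensor Pp Qq); exact: cat_map_id.
Qed.

Lemma color_tensor_l k k' l l' (p : cpart k l) (q : cpart k' l') x :
  color (tensor p q) (inl x) = side (fun i => color p (inl i)) (fun i => color q (inl i)) x.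
Proof. by rewrite /tensor /color /= ffunE /side /=; case: (split x). Qed.

Lemma color_tensor_r k k' l l' (p : cpart k l) (q : cpart k' l') x :
  color (tensor p q) (inr x) = side (fun i => color p (inr i)) (fun i => color q (inr i)) x.
Proof. by rewrite /tensor /color /= ffunE /side /=; case: (split x). Qed.

Lemma balanced_tensor k l (p : cpart k k) (q : cpart l l) :
  balanced p -> balanced q -> balanced (tensor p q).
Proof.
by move=> bp bq; elim/side_ind => x; rewrite color_tensor_l color_tensor_r ?side_l ?side_r.
Qed.

End Tensor.

(** * Partial traces *)

Section PartialTrace.

Lemma trace_thruP (I J : finType) (f : J -> I) (P : profile I) x y : P (f x) (f y) ->
  thru P (f x) || [exists z, (z \notin codom f) && P (f x) z] =
  thru P (f y) || [exists z, (z \notin codom f) && P (f y) z].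
Proof.
move=> xy; rewrite (thruP xy); congr (_ || _).
by apply: eq_existsb => z; rewrite (prof_eq xy).
Qed.

(** The effect on profiles of joining the two copies of every point outside the
image of [f]: a class becomes through as soon as it contains such a point. *)
Definition trace_prof (I J : finType) (f : J -> I) (P : profile I) : profile J :=
  Profile (relpre_equivalence f (prelP P)) (@trace_thruP _ _ f P).

Lemma encodes_ext I (P P' : profile I) k l (a : 'I_k -> I) (b : 'I_l -> I) p :
  P =2 P' -> thru P =1 thru P' -> encodes P a b p -> encodes P' a b p.
Proof. by move=> e t Pp u v; rewrite Pp /level_rel e t. Qed.

Variable right : bool.
Local Notation f k := (lift (end_ord right k)).

Lemma codom_lift k z : (z \notin codom (f k)) = (z == end_ord right k).
Proof.
case: (unliftP (end_ord right k) z) => [y ->|->].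
  by rewrite codom_f eq_sym (negPf (neq_lift _ _)).
rewrite eqxx; apply/codomP => -[y e]; have := neq_lift (end_ord right k) y.
by rewrite -e eqxx.
Qed.

(** The partial trace of [m] over its last (or first) point $z$, if $mm=m$. In the
composition, the middle row contains the points other than $z$, where the two
copies of [m] are composed as in $mm$, and one more point, where the upper $z$
of the top copy meets the lower $z$ of the bottom copy. *)
Definition trace1 k (m : cpart k.+1 k.+1) : cpart k k :=
  comp (rot_up right m) (rot_down right m).

Definition mid_pt k (j : 'I_k.+2) : 'I_k.+1 := odflt (end_ord right k) (unlift (end_ord right k.+1) j).

Definition trace_label k (u : rows3 k k.+2 k) : 'I_k.+1 :=
  match u with inl (inl x) => f k x | inl (inr j) => mid_pt j | inr y => f k y end.

(** Levels 0, 1 and 2 are the upper row of the top copy of [m], the row where the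
two copies are composed, and the lower row of the bottom copy. *)
Definition trace_level k (u : rows3 k k.+2 k) : nat :=
  match u with
  | inl (inl _) => 0
  | inl (inr j) => if unlift (end_ord right k.+1) j is Some _ then 1 else 2
  | inr _ => 2 end.

Lemma encodes_trace1 k (P : profile 'I_k.+1) (m : cpart k.+1 k.+1) :
  encodes P id id m -> encodes (trace_prof (f k) P) id id (trace1 m).
Proof.
move=> Pm u v; pose z := end_ord right k.
(* The extra middle point lies at levels 0 and 2 at once, so these two levels
   are identified on the class of [z]. *)
pose lev (w : rows3 k k.+2 k) :=
  if P (trace_label w) z && (trace_level w != 1) then 0 else trace_level w.
pose R : rel (rows3 k k.+2 k) := fun w w' => P (trace_label w) (trace_label w') &&
  (thru P (trace_label w) || (lev w == lev w')).
have thrE x : thru (trace_prof (f k) P) x = thru P (f k x) || P (f k x) z.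
  rewrite /=; congr (_ || _); apply/existsP/idP => [[y]|h].
    by rewrite codom_lift => /andP[/eqP ->].
  by exists z; rewrite codom_lift eqxx.
have RP : equivalence_rel R.
  apply/equivalence_relP; split=> [w|w w']; first by rewrite /R profxx eqxx orbT.
  move=> /andP[ww tw] w2; rewrite /R (prof_eq ww).
  by rewrite (thruP ww) in tw *; case/orP: tw => [->|/eqP ->].
rewrite linked_comp; apply/idP/idP => [h|].
  suff : R (outer k.+2 u) (outer k.+2 v).
    rewrite /level_rel thrE /R /lev.
    case: u v {h} => u [] v /= => /andP[uv]; rewrite uv ?eqxx ?orbT //=;
    rewrite -?(prof_eq uv); case: (thru P _) => //=; by case: (P _ z).
  apply: connect_stacked_sub h => //.
  have down_lab x : trace_label (inl x) = label id id (unrot_down right x).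
    by case: x => [x|x] //=; rewrite /mid_pt; case: unlift.
  have down_lev x : lev (inl x) = lower (unrot_down right x).
    case: x => [x|x]; rewrite /lev /=; first by rewrite andbT if_same.
    by rewrite /mid_pt; case: unlift => [y|] /=; rewrite ?andbF // profxx.
  have up_lab x : trace_label (bottom_row k x) = label id id (unrot_up right x).
    by case: x => [x|x] //=; rewrite /mid_pt; case: unlift.
  have up_lev x : lev (bottom_row k x) = if lower (unrot_up right x)
      then (if P (label id id (unrot_up right x)) z then 0 else 2) else 1.
    case: x => [x|x]; rewrite /lev /=; last by rewrite andbT.
    by rewrite /mid_pt; case: unlift => [y|] /=; rewrite ?andbF // profxx.
  apply: stackedP => x y; rewrite linked_part_of_rel /= Pm /R /level_rel.
    by rewrite !down_lab !down_lev => /andP[-> /orP[->|/eqP->]] //; rewrite eqxx orbT.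
  rewrite !up_lab !up_lev => /andP[xy /orP[->|/eqP->]]; first by rewrite xy.
  by rewrite xy (prof_eq xy) eqxx orbT.
have lift_in j : unlift (end_ord right k.+1) (lift (end_ord right k.+1) j) = Some j.
  exact: liftK.
have tb x y : P (f k x) (f k y) -> thru P (f k x) || P (f k x) z ->
    connect (stacked (rot_up right m) (rot_down right m)) (inl (inl x)) (inr y).
  move=> xy; case/orP=> [tx|xz].
    apply: (@connect_trans _ _ (inl (inr (lift (end_ord right k.+1) (f k x))))).
      apply/connect1/stacked_top; rewrite linked_part_of_rel /= lift_in Pm /level_rel /=.
      by rewrite profxx tx.
    apply/connect1/(@stacked_bottom k _ _ (rot_up right m) (rot_down right m) (inl _) (inr y)).
    by rewrite linked_part_of_rel /= lift_in Pm /level_rel /= xy tx.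
  apply: (@connect_trans _ _ (inl (inr (end_ord right k.+1)))).
    apply/connect1/stacked_top; rewrite linked_part_of_rel /= unlift_none Pm /level_rel /=.
    by rewrite xz orbT.
  apply/connect1/(@stacked_bottom k _ _ (rot_up right m) (rot_down right m) (inl _) (inr y)).
  rewrite linked_part_of_rel /= unlift_none Pm /level_rel /=.
  by rewrite profC -(prof_eq xy) xz orbT.
case: u v => x [] y; rewrite /level_rel thrE /= ?orbT ?orbF ?andbT.
- move=> xy; apply/connect1/stacked_top; rewrite linked_part_of_rel /= Pm /level_rel /=.
  by rewrite xy orbT.
- by case/andP; exact: tb.
- case/andP=> xy tx; rewrite stacked_sym; apply: tb; first by rewrite profC.
  by rewrite -(thruP xy) -(prof_eq xy).
move=> xy; apply/connect1/(@stacked_bottom k _ _ (rot_up right m) (rot_down right m) (inr x) (inr y)).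
by rewrite linked_part_of_rel /= Pm /level_rel /= xy orbT.
Qed.

Variable C : forall k l, {set cpart k l}.
Hypothesis hC : category C.

Lemma color_relabel k1 l1 k2 l2 (g : pt k2 l2 -> pt k1 l1) (p : cpart k1 l1) c :
  color (relabel g p c) = c.
Proof. by []. Qed.

Lemma trace1_color k (m : cpart k.+1 k.+1) : balanced m ->
  [/\ lcol (rot_down right m) = ucol (rot_up right m),
      forall x, color (trace1 m) (inl x) = color m (inl (f k x)) &
      forall x, color (trace1 m) (inr x) = color m (inr (f k x))].
Proof.
move=> bm; split=> [|x|x].
- apply/ffunP => j; rewrite !ffunE; move: j => /= j.
  case: (unliftP (end_ord right k.+1) j) => [i|] ->.
    by rewrite -(bm i); congr (_ (+) _).
  by rewrite -(bm (end_ord right k)) !eqxx.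
- by rewrite color_comp /rot_down /rot_up color_relabel ffunE /= addbF.
by rewrite color_comp /rot_down /rot_up color_relabel ffunE /= addbF.
Qed.

(** Removing [j] points one by one. The hypothesis [E] lets the lemma apply to
both halves of a row of size $k+l$. *)
Lemma partial_trace j k n (E : n = (j + k)%N) (m : cpart n n) (P : profile 'I_n) :
  m \in C n n -> encodes P id id m -> balanced m ->
  exists2 g : 'I_k -> 'I_n, (forall x, val (g x) = if right then val x else (j + x)%N) &
  exists m0 : cpart k k, [/\ m0 \in C k k, encodes (trace_prof g P) id id m0, balanced m0 &
    forall x, color m0 (inl x) = color m (inl (g x))].
Proof.
elim: j n E m P => [|j IH] n E m P mC Pm bm; subst n.
  exists id => [x|]; first by case: right.
  exists m; split=> //; apply: encodes_ext Pm => // x /=.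
  rewrite orbC; case: existsP => // -[z]; rewrite -{2}[z]/(id z) codom_f //.
have [cc cl cr] := trace1_color bm.
have m1C : trace1 m \in C (j + k)%N (j + k)%N.
  by apply: (cat_comp hC) => //; [apply: (cat_rot_up hC) | apply: (cat_rot_down hC)].
have b1 : balanced (trace1 m) by move=> x; rewrite cl cr bm.
have [g gE [m0 [m0C Pm0 b0 c0]]] := IH _ erefl _ _ m1C (encodes_trace1 Pm) b1.
exists (fun x => f (j + k)%N (g x)) => [x|].
  rewrite /= gE /end_ord; case: (right) gE => gE; rewrite /bump /=.
    by rewrite leqNgt (_ : x < j + k)%N //; apply: leq_trans (ltn_ord x) (leq_addl _ _).
  by [].
exists m0; split=> // [|x]; last by rewrite c0 cl.
apply: encodes_ext Pm0 => // x /=.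
rewrite -orbA; congr (_ || _); apply/orP/existsP => [|[z /andP[nz xz]]].
  case=> /existsP[z /andP[nz xz]].
    exists z; rewrite xz andbT; rewrite codom_lift in nz.
    apply/codomP => -[y ey]; move: nz; rewrite ey eq_sym => /eqP/eqP.
    by rewrite (negPf (neq_lift _ _)).
  exists (f (j + k)%N z); rewrite xz andbT; apply: contra nz => /codomP[y /lift_inj ->].
  exact: codom_f.
case: (unliftP (end_ord right (j + k)) z) => [y ey|ez].
  right; apply/existsP; exists y; rewrite -ey xz andbT; apply: contra nz => /codomP[i ei].
  by rewrite ey ei; apply/codomP; exists i.
left; apply/existsP; exists z; rewrite codom_lift xz andbT; exact/eqP.
Qed.

End PartialTrace.

Lemma color_adj k l (p : cpart k l) u : color (adj p) u = color p (flip u).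
Proof. by rewrite /adj /color /= ffunE. Qed.

(** * Upper parts *)

Section Upart.
Variable k : nat.
Implicit Type p : cpart k k.

(** Whichever upper part is taken, $p=p_u^*p_u$ forces its upper row to have the
profile of [p], and its lower points to enumerate the through-blocks of [p]
without repetition; [r] picks an upper point in each of them. *)
Lemma is_upart_data p (s : cpart k (nthrough p)) : is_upart s ->
  exists2 r : 'I_(nthrough p) -> 'I_k,
    [/\ encodes (upper p) id r s, (forall c d, upper p (r c) (r d) -> c = d),
        (forall c, thru (upper p) (r c)) &
        forall x, thru (upper p) x -> exists c, upper p x (r c)] &
    forall x, color s (inl x) = color p (inl x) /\ color s (inl x) = color p (inr x).
Proof.
case/andP=> /and4P[_ /'forall_forallP inj ex _] /eqP sp.
have [r rP] : exists r : 'I_(nthrough p) -> 'I_k, forall c, linked s (inr c) (inl (r c)).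
  pose w c := xchoose (existsP (forallP ex c)); exists w => c.
  exact: (xchooseP (existsP (forallP ex c))).
have Us := encodes_upper rP.
have surj x : thru (upper s) x -> exists c, upper s x (r c).
  by case/existsP=> c xc; exists c; apply: linked_trans xc (rP c).
have Up : encodes (upper s) id id (comp (adj s) s).
  apply: encodes_comp_top Us (encodes_adj Us) => //; exact: refines_refl.
rewrite sp in Up.
have [e1 e2] := encodes_id_upper Up.
exists r; first split.
- exact: encodes_ext Us.
- move=> c d; rewrite -e1 => cd; apply/eqP; apply: (implyP (inj c d)).
  apply: linked_trans (rP c) _; apply: linked_trans cd _; rewrite linkedC; exact: rP.
- by move=> c; rewrite -e2; apply/existsP; exists c; rewrite linkedC.
- by move=> x; rewrite -e2 => /surj[c]; rewrite e1; exists c.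
have cE u : color p u = color (comp (adj s) s) u by rewrite sp.
by move=> x; rewrite !cE !color_comp color_adj.
Qed.

Definition block_min (P : profile 'I_k) : {set 'I_k} :=
  [set x | thru P x && [forall y, P x y ==> (x <= y)]]%N.

Lemma block_minP (P : profile 'I_k) x : thru P x ->
  exists2 y, y \in block_min P & P x y.
Proof.
move=> tx; have [y xy ymin] := arg_minnP (fun y : 'I_k => y : nat) (profxx P x).
exists y => //; rewrite inE -(thruP xy) tx; apply/forallP => z; apply/implyP => yz.
by apply: ymin; apply: prof_trans yz.
Qed.

Lemma block_min_inj (P : profile 'I_k) x y :
  x \in block_min P -> y \in block_min P -> P x y -> x = y.
Proof.
rewrite !inE => /andP[_ /forallP hx] /andP[_ /forallP hy] xy.
apply/val_inj/anti_leq; rewrite (implyP (hx y)) //=; apply: (implyP (hy x)).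
by rewrite profC.
Qed.

Lemma card_block_min p : projective p -> #|block_min (upper p)| = nthrough p.
Proof.
case/projective_encodes=> Up _.
have inb x : pblock (blocks p) (inl x) \in blocks p.
  by apply: finset.pblock_mem; rewrite (finset.cover_partition (cpartP p)) inE.
rewrite /nthrough -(card_in_imset (f := fun x => pblock (blocks p) (inl x)) (D := block_min (upper p))); last first.
  move=> x y xm ym exy; apply: block_min_inj xm ym _.
  by rewrite /= /upper_rel /linked exy; exact: linkedxx.
apply/esym/eq_card => B; rewrite inE; apply/andP/imsetP => [[BP /andP[/existsP[x xB] /existsP[y yB]]]|[x xm ->]].
  have eB := finset.def_pblock (finset.partition_trivIset (cpartP p)) BP xB.
  have tx : thru (upper p) x by apply/existsP; exists y; rewrite /linked eB.
  have [z zm xz] := block_minP tx; exists z => //; rewrite -eB.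
  by apply/esym/finset.same_pblock; first exact: finset.partition_trivIset (cpartP p).
split=> //; apply/andP; split; apply/existsP; first by exists x; exact: (linkedxx p).
move: xm; rewrite inE => /andP[/existsP[y xy] _]; by exists y.
Qed.

(** The through-blocks are numbered by the order of their smallest points, so that
the last condition on building partitions holds. *)
Lemma is_upart_exists p : projective p -> exists s, @is_upart k p s.
Proof.
move=> pP; have [Up bp] := projective_encodes pP; have E := card_block_min pP.
move: (upper p) Up E => P Up E.
suff [s bs sp] : exists2 s : cpart k #|block_min P|, building s & comp (adj s) s = p.
  move: s bs sp; rewrite E => s bs sp; exists s; rewrite /is_upart bs; exact/eqP.
pose r : 'I_#|block_min P| -> 'I_k := enum_val.
have rP c : r c \in block_min P := enum_valP c.
have r_inj : injective r := @enum_val_inj _ _.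
have r_mono (c d : 'I_#|block_min P|) : (c < d -> r c < r d)%N.
  have rE (e : 'I_#|block_min P|) : r e = nth (r c) (enum (block_min P)) e.
    exact: enum_val_nth.
  move=> cd; rewrite (rE c) (rE d); have st : sorted (relpre val ltn) (enum (block_min P)).
    rewrite /enum_mem -enumT; apply: sorted_filter.
      by move=> y x z; exact: ltn_trans.
    by rewrite -sorted_map val_enum_ord iota_ltn_sorted.
  have tr : transitive (relpre (val : 'I_k -> nat) ltn) by move=> y x z; exact: ltn_trans.
  have := sorted_ltn_nth tr (r c) st; move=> /(_ (val c) (val d)); rewrite !inE -!cardE.
  by move=> h; exact: (h (ltn_ord c) (ltn_ord d) cd).
pose s : cpart k #|block_min P| :=
  part_of_rel (level_rel_equivalence (label id r) (@lower _ _) P)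
    [ffun u => if u is inl x then color p (inl x) else false].
have Ps : encodes P id r s by move=> u v; rewrite linked_part_of_rel.
have tr c : thru P (r c) by move: (rP c); rewrite inE => /andP[].
have minr c i : is_minup s c i -> i = r c.
  case/andP=> ci /forallP h; move: (rP c); rewrite inE => /andP[_ /forallP h'].
  have rci : P (r c) i by move: ci; rewrite Ps => /andP[].
  apply/val_inj/anti_leq; rewrite (implyP (h' i) rci) andbT; apply: (implyP (h (r c))).
  by rewrite Ps /level_rel /= profxx tr.
exists s; last first.
  have sur y : thru P y -> exists j, P y (r j).
    by case/block_minP=> z zm yz; exists (enum_rank_in zm z); rewrite /r enum_rankK_in.
  have := encodes_comp_top (refines_refl P) sur Ps (encodes_adj Ps) => cE.
  apply: cpart_ext => [u v|[x|x]]; first by rewrite cE Up.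
    by rewrite color_comp /color /= ffunE.
  by rewrite color_comp color_adj /color /= ffunE bp.
apply/and4P; split.
- by apply/eqP/ffunP => c; rewrite !ffunE.
- apply/'forall_forallP => c d; apply/implyP; rewrite Ps => /andP[/= cd _].
  by apply/eqP/r_inj/(block_min_inj (rP c) (rP d)).
- by apply/forallP => c; apply/existsP; exists (r c); rewrite Ps /level_rel /= profxx tr.
apply/'forall_'forall_'forall_forallP => c d i j; apply/implyP => /and3P[cd /minr-> /minr->].
exact: r_mono.
Qed.

End Upart.

(** * Mixing partitions *)

Section Mixing.
Variables k l : nat.

(** Mixing partitions read on profiles: a class has at most one point in each half,
and a class with one point only is through. *)
Definition mixed (P : profile 'I_(k + l)) : Prop :=
  [/\ forall a b, P (lshift l a) (lshift l b) -> a = b,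
      forall a b, P (rshift k a) (rshift k b) -> a = b &
      forall c, (forall d, P c d -> d = c) -> thru P c].

Lemma mixing_blockE (B : {set pt (k + l) (k + l)}) c :
  mixing_block B -> inl c \in B -> B = [set inl c; inr c] \/
  exists a b, forall d, (inl d \in B) = (d == lshift l a) || (d == rshift k b).
Proof.
have iE (d x : 'I_(k + l)) : (inl d == inl x :> pt (k + l) (k + l)) = (d == x) by [].
have rE (d x : 'I_(k + l)) : (inl d == inr x :> pt (k + l) (k + l)) = false by [].
case/or4P => [/existsP[x /eqP->]|/existsP[x /existsP[y /eqP->]]
    |/existsP[x /existsP[y /eqP->]]|/existsP[x /existsP[y /eqP->]]].
- by rewrite !inE iE rE orbF => /eqP ->; left.
- by right; exists x, y => d; rewrite !inE !iE.
- by rewrite !inE !rE.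
by right; exists x, y => d; rewrite !inE !iE !rE /= !orbF.
Qed.

Lemma mixing_mixed (h : cpart (k + l) (k + l)) : mixing h -> mixed (upper h).
Proof.
case/and3P=> hP _ /forall_inP hB.
have cB c : inl c \in pblock (blocks h) (inl c) by exact: linkedxx.
have mb c : pblock (blocks h) (inl c) = [set inl c; inr c] \/ exists a b, forall d,
    upper h c d = (d == lshift l a) || (d == rshift k b).
  apply: mixing_blockE (cB c).
  by apply: hB; apply: finset.pblock_mem; rewrite (finset.cover_partition (cpartP h)) inE.
have solo c d : pblock (blocks h) (inl c) = [set inl c; inr c] -> upper h c d -> d = c.
  move=> e; rewrite /= /upper_rel /linked e !inE orbF => /eqP [] //.
have cC c : upper h c c by exact: profxx.
split=> [a b ab|a b ab|c alone].
- case: (mb (lshift l a)) => [/solo/(_ ab)/lshift_inj //|[x [y xyE]]].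
  move: (cC (lshift l a)) ab; rewrite !xyE !eq_lrshift !orbF.
  by rewrite !(inj_eq (@lshift_inj _ _)) => /eqP -> /eqP.
- case: (mb (rshift k a)) => [/solo/(_ ab)/rshift_inj //|[x [y xyE]]].
  move: (cC (rshift k a)) ab; rewrite !xyE !eq_rlshift /=.
  by rewrite !(inj_eq (@rshift_inj _ _)) => /eqP -> /eqP.
case: (mb c) => [e|[x [y xyE]]].
  by apply/existsP; exists c; rewrite /linked e !inE eqxx orbT.
have e1 : lshift l x = c by apply: alone; rewrite xyE eqxx.
have : rshift k y = c by apply: alone; rewrite xyE eqxx orbT.
by rewrite -e1 => /eqP; rewrite eq_rlshift.
Qed.

Lemma mixed_mixing (P : profile 'I_(k + l)) (h : cpart (k + l) (k + l)) :
  encodes P id id h -> color h = [ffun=> false] -> mixed P -> mixing h.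
Proof.
move=> Ph ch [m1 m2 m3]; apply/and3P; split; last 2 first.
- exact/eqP.
- apply/forall_inP => B BP.
  have [u uB] : exists u, u \in B.
    by apply/set0Pn; apply: contraTneq BP => ->; have /and3P[] := cpartP h.
  have eB v : (v \in B) = linked h u v.
    by rewrite /linked (finset.def_pblock (finset.partition_trivIset (cpartP h)) BP uB).
  pose c := label id id u.
  have eB' v : (v \in B) = P c (label id id v) && (thru P c || (lower u == lower v)).
    by rewrite eB Ph.
  have [alone|] := pselect (forall d, P c d -> d = c).
    apply/or4P; constructor 1; apply/existsP; exists c; apply/eqP/setP => v.
    rewrite eB' m3 // andbT !inE; apply/idP/orP => [/alone|[/eqP->|/eqP->]];
      rewrite /= ?profxx //.
    by case: v => v /= ->; [left|right].
  move/existsNP=> [d /not_implyP[cd /eqP dc]].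
  have [a [b [ca cb]]] : exists a b, P c (lshift l a) /\ P c (rshift k b).
    have: P c c by exact: profxx.
    move: (c) d cd dc => {c eB'}; elim/side_ind => c; elim/side_ind => d cd dc cc.
    - by rewrite (m1 _ _ cd) eqxx in dc.
    - by exists c, d.
    - by exists d, c.
    by rewrite (m2 _ _ cd) eqxx in dc.
  have cl i : P c i -> i = lshift l a \/ i = rshift k b.
    rewrite profC; elim/side_ind: i => i ic; [left|right]; congr (_ _ _).
      by apply: m1; exact: prof_trans ic ca.
    by apply: m2; exact: prof_trans ic cb.
  have cE i : P c i = (i == lshift l a) || (i == rshift k b).
    by apply/idP/orP => [/cl[->|->]|[/eqP->|/eqP->]] //; rewrite eqxx; [left|right].
  case: (boolP (thru P c)) eB' => [tc|ntc] eB'.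
    apply/or4P; constructor 4; apply/existsP; exists a; apply/existsP; exists b.
    apply/eqP/setP => v; rewrite eB' andbT cE !inE.
    by case: v => v /=; rewrite ?(inj_eq (@inl_inj _ _)) ?(inj_eq (@inr_inj _ _)) -?orbA /= ?orbF.
  case: (u) eB' => u0 eB'; apply/or4P; [constructor 2|constructor 3];
   (apply/existsP; exists a; apply/existsP; exists b; apply/eqP/setP => v;
    rewrite eB' cE !inE; case: v => v /=;
    by rewrite ?(inj_eq (@inl_inj _ _)) ?(inj_eq (@inr_inj _ _)) ?orbF ?andbF ?andbT).
apply: encodes_projective Ph _ => x; by rewrite ch !ffunE.
Qed.

End Mixing.

(** * The set $X$ as a condition on profiles *)

Lemma ucolE k l (p : cpart k l) x : ucol p x = color p (inl x).
Proof. exact: ffunE. Qed.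

Section Tight.
Variables k l : nat.

(** The profile [M] of a partition below $p\otimes q$ has the profiles [P] and [Q] of
$p$ and $q$ as its two partial traces. *)
Record tight (P : profile 'I_k) (Q : profile 'I_l) (M : profile 'I_(k + l)) : Prop := Tight {
  tight_l : forall x y, M (lshift l x) (lshift l y) -> P x y;
  tight_r : forall x y, M (rshift k x) (rshift k y) -> Q x y;
  tight_tl : forall x, thru P x ->
    thru M (lshift l x) \/ exists y, M (lshift l x) (rshift k y);
  tight_tr : forall x, thru Q x ->
    thru M (rshift k x) \/ exists y, M (rshift k x) (lshift l y) }.

Lemma projective_ext n (p m : cpart n n) : projective p -> projective m ->
  ucol m = ucol p -> refines (upper m) (upper p) -> refines (upper p) (upper m) -> m = p.
Proof.
move=> /projective_encodes[Up bp] /projective_encodes[Um bm] uc r1 r2.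
have [e t] := refines_anti r1 r2; apply: cpart_ext; last exact: eq_ucol.
by move=> u v; rewrite Up Um /level_rel e t.
Qed.

Lemma preceq_upperP n (p m : cpart n n) : projective p -> projective m ->
  reflect (ucol m = ucol p /\ refines (upper m) (upper p)) (preceq m p).
Proof. by move=> /projective_encodes[Up bp] /projective_encodes[Um bm]; exact: preceqP. Qed.

Lemma preceq_refl n (m : cpart n n) : projective m -> preceq m m.
Proof. by move=> mP; apply/preceq_upperP => //; split=> //; exact: refines_refl. Qed.

Lemma preceq_trans n (m r s : cpart n n) : projective m -> projective r -> projective s ->
  preceq s r -> preceq r m -> preceq s m.
Proof.
move=> mP rP sP /(preceq_upperP rP sP)[e1 r1] /(preceq_upperP mP rP)[e2 r2].
apply/(preceq_upperP mP sP); rewrite e1; split=> //; exact: refines_trans r1 r2.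
Qed.

Lemma preceq_anti n (m r : cpart n n) : projective m -> projective r ->
  preceq r m -> preceq m r -> r = m.
Proof.
move=> mP rP /(preceq_upperP mP rP)[e1 r1] /(preceq_upperP rP mP)[_ r2].
exact: projective_ext.
Qed.

Definition down_set n (m : cpart n n) : {set cpart n n} :=
  [set r | projective r && preceq r m].

Lemma in_down_set n (r m : cpart n n) : (r \in down_set m) = projective r && preceq r m.
Proof. exact: finset.in_set. Qed.

Lemma prec_down_set d (m n : cpart d d) : projective m -> projective n -> prec n m ->
  #|down_set n| < #|down_set m|.
Proof.
move=> mP nP /andP[nm neq]; apply/proper_card/properP; split.
  have sub r (rn : r \in down_set n) : r \in down_set m.
    have /andP[rP {}rn] : projective r && preceq r n by rewrite -in_down_set.
    by rewrite in_down_set rP (preceq_trans mP nP rP rn nm).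
  by apply/fintype.subsetP; exact: sub.
exists m; first by rewrite in_down_set mP preceq_refl.
rewrite in_down_set mP andTb; apply: contra neq => mn.
by apply/eqP; exact: (preceq_anti mP nP nm mn).
Qed.

Variables (p : cpart k k) (q : cpart l l).
Hypotheses (pP : projective p) (qP : projective q).
Let P := upper p.
Let Q := upper q.

Lemma preceq_tensorP (p' : cpart k k) (q' : cpart l l) (P' : profile 'I_k) (Q' : profile 'I_l) m :
  encodes P' id id p' -> balanced p' -> encodes Q' id id q' -> balanced q' -> projective m ->
  reflect (ucol m = ucol (tensor p' q') /\ refines (upper m) (cat_prof P' Q'))
          (preceq m (tensor p' q')).
Proof.
move=> Up bp Uq bq /projective_encodes[Um bm].
by apply: preceqP => //; [exact: encodes_tensor_id | exact: balanced_tensor].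
Qed.

Lemma ucol_tensor_eq (p1 p2 : cpart k k) (q1 q2 : cpart l l) :
  ucol p1 = ucol p2 -> ucol q1 = ucol q2 -> ucol (tensor p1 q1) = ucol (tensor p2 q2).
Proof.
move=> /ffunP e1 /ffunP e2; apply/ffunP; elim/side_ind => x;
  rewrite !ucolE !color_tensor_l ?side_l ?side_r -!ucolE.
  exact: e1.
exact: e2.
Qed.

Variable C : forall k l, {set cpart k l}.

(** If $m\preceq l\otimes q$ then the relation of $l$ lies inside that of [m], hence
inside that of [p] by [tight_l]; and $l$ cannot cut a through-block of [p], which
in [m] is through or joined to the other half. So $l\preceq p$ gives $l=p$. *)
Lemma tight_X m : m \in C (k + l) (k + l) -> projective m ->
  preceq m (tensor p q) -> tight P Q (upper m) -> m \in X C p q.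
Proof.
move=> mC mP mpq [t1 t2 t3 t4]; rewrite inE mC mP mpq /=.
have [Up bp] := projective_encodes pP; have [Uq bq] := projective_encodes qP.
apply/andP; split; apply/forall_inP => n _; apply/implyP => /andP[nP /andP[np]];
  apply: contraNN => mn; have [Un bn] := projective_encodes nP.
  have [uc lp] := preceq_upperP pP nP np.
  apply/eqP; apply: projective_ext => //.
  have [_ [r1 r2 r3]] := elimT (preceq_tensorP Un bn Uq bq mP) mn.
  have [l1 _ _] := lp.
  split=> [x y xy|x y /l1 -> //|x /t3[/r3|[y /r2]]].
  - by apply/t1/r1; rewrite cat_ll.
  - by rewrite cat_tl.
  by rewrite cat_lr cat_tl => /andP[].
have [uc lp] := preceq_upperP qP nP np.
apply/eqP; apply: projective_ext => //.
have [_ [r1 r2 r3]] := elimT (preceq_tensorP Up bp Un bn mP) mn.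
have [l1 _ _] := lp.
split=> [x y xy|x y /l1 -> //|x /t4[/r3|[y /r2]]].
- by apply/t2/r1; rewrite cat_rr.
- by rewrite cat_tr.
by rewrite cat_rl cat_tr => /andP[].
Qed.

Hypothesis hC : category C.

(** Both partial traces of $m\in X$ are in $C$, and $m$ lies below the tensor product
of either of them with the other factor; they are therefore $p$ and $q$. *)
Lemma X_tight m : m \in X C p q -> tight P Q (upper m).
Proof.
rewrite inE => /andP[mC /and4P[mP mpq /forall_inP hl /forall_inP hr]].
have [Up bp] := projective_encodes pP; have [Uq bq] := projective_encodes qP.
have [Um bm] := projective_encodes mP.
have [uc [m1 m2 m3]] := elimT (preceq_tensorP Up bp Uq bq mP) mpq.
have ucl x : color m (inl (lshift l x)) = color p (inl x).
  by have /ffunP/(_ (lshift l x)) := uc; rewrite !ucolE color_tensor_l side_l.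
have ucr x : color m (inl (rshift k x)) = color q (inl x).
  by have /ffunP/(_ (rshift k x)) := uc; rewrite !ucolE color_tensor_l side_r.
have [g gE [p' [p'C Up' bp' cp']]] := partial_trace true hC (addnC k l) mC Um bm.
have {}gE x : g x = lshift l x by apply: val_inj; rewrite gE.
have [g' gE' [q' [q'C Uq' bq' cq']]] := partial_trace false hC (erefl (k + l)) mC Um bm.
have {}gE' x : g' x = rshift k x by apply: val_inj; rewrite gE'.
have ngr y : rshift k y \notin codom g.
  by apply/codomP => -[x]; rewrite gE => /eqP; rewrite eq_rlshift.
have ngl y : lshift l y \notin codom g'.
  by apply/codomP => -[x]; rewrite gE' => /eqP; rewrite eq_lrshift.
have inl_codom y : lshift l y \in codom g by rewrite -gE codom_f.
have inr_codom y : rshift k y \in codom g' by rewrite -gE' codom_f.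
set P' := trace_prof g (upper m) in Up'; set Q' := trace_prof g' (upper m) in Uq'.
have P'E x y : P' x y = upper m (lshift l x) (lshift l y) by rewrite /= !gE.
have Q'E x y : Q' x y = upper m (rshift k x) (rshift k y) by rewrite /= !gE'.
have P'T x : reflect (thru (upper m) (lshift l x) \/ exists y, upper m (lshift l x) (rshift k y))
    (thru P' x).
  apply: (iffP orP); rewrite gE; (case=> [tx|]; first by left); [move=> /existsP[y]|move=> [y xy]].
    by move: y; elim/side_ind => y; rewrite ?inl_codom // => /andP[_ xy]; right; exists y.
  by right; apply/existsP; exists (rshift k y); rewrite ngr.
have Q'T x : reflect (thru (upper m) (rshift k x) \/ exists y, upper m (rshift k x) (lshift l y))
    (thru Q' x).
  apply: (iffP orP); rewrite gE'; (case=> [tx|]; first by left); [move=> /existsP[y]|move=> [y xy]].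
    by move: y; elim/side_ind => y; rewrite ?inr_codom // => /andP[_ xy]; right; exists y.
  by right; apply/existsP; exists (lshift l y); rewrite ngl.
have upp : ucol p' = ucol p by apply/ffunP => x; rewrite !ucolE cp' gE ucl.
have uqq : ucol q' = ucol q by apply/ffunP => x; rewrite !ucolE cq' gE' ucr.
have lep : preceq p' p.
  apply/(preceqP Up Up' bp' bp); split=> //; split=> [x y xy|x y|x /P'T[/m3|[y /m2]]].
  - by rewrite P'E m1 // cat_ll.
  - by rewrite P'E => /m2; rewrite cat_ll !cat_tl.
  - by rewrite cat_tl.
  by rewrite cat_lr cat_tl => /andP[].
have leq' : preceq q' q.
  apply/(preceqP Uq Uq' bq' bq); split=> //; split=> [x y xy|x y|x /Q'T[/m3|[y /m2]]].
  - by rewrite Q'E m1 // cat_rr.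
  - by rewrite Q'E => /m2; rewrite cat_rr !cat_tr.
  - by rewrite cat_tr.
  by rewrite cat_rl cat_tr => /andP[].
have p'p : p' = p.
  apply/eqP; apply: contraT => np.
  have := hl _ p'C; rewrite (encodes_projective Up' bp') /prec lep np /= => /negP; case.
  apply/(preceq_tensorP Up' bp' Uq bq mP); split.
    by rewrite uc; apply: ucol_tensor_eq.
  split; elim/side_ind => x; try (elim/side_ind => y); rewrite ?catE //.
  - by rewrite P'E.
  - by move=> xy; apply: m1; rewrite cat_rr.
  - by rewrite P'E => ->.
  - move=> xy; have := m2 _ _ xy; rewrite !catE /= => /andP[_ ->]; rewrite andbT.
    by apply/P'T; right; exists y.
  - move=> xy; have := m2 _ _ xy; rewrite !catE /= => /andP[-> _] /=.
    by apply/P'T; right; exists x; rewrite profC.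
  - by move=> /m2; rewrite !catE.
  - by move=> tx; apply/P'T; left.
  by move=> /m3; rewrite catE.
have q'q : q' = q.
  apply/eqP; apply: contraT => nq.
  have := hr _ q'C; rewrite (encodes_projective Uq' bq') /prec leq' nq /= => /negP; case.
  apply/(preceq_tensorP Up bp Uq' bq' mP); split.
    by rewrite uc; apply: ucol_tensor_eq.
  split; elim/side_ind => x; try (elim/side_ind => y); rewrite ?catE //.
  - by move=> xy; apply: m1; rewrite cat_ll.
  - by rewrite Q'E.
  - by move=> /m2; rewrite !catE.
  - move=> xy; have := m2 _ _ xy; rewrite !catE /= => /andP[-> _] /=.
    by apply/Q'T; right; exists x; rewrite profC.
  - move=> xy; have := m2 _ _ xy; rewrite !catE /= => /andP[_ ->]; rewrite andbT.
    by apply/Q'T; right; exists y.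
  - by rewrite Q'E => ->.
  - by move=> /m3; rewrite catE.
  by move=> tx; apply/Q'T; left.
rewrite p'p in Up'; rewrite q'q in Uq'.
have [eP tP] := encodes_id_upper Up'; have [eQ tQ] := encodes_id_upper Uq'.
split=> [x y|x y|x|x].
- by rewrite /P -eP P'E.
- by rewrite /Q -eQ Q'E.
- by rewrite /P -tP => /P'T.
by rewrite /Q -tQ => /Q'T.
Qed.

End Tight.

(** * The set $Y$ as a condition on profiles *)

Section Gluing.

(** A profile on the through-classes of [P], indexed by [r], induces one on the
points: two classes are merged when [Q] relates their indices. *)
Lemma glue_profile n t (P : profile 'I_n) (r : 'I_t -> 'I_n) (Q : profile 'I_t) :
  (forall c d, P (r c) (r d) -> c = d) -> (forall c, thru P (r c)) ->
  (forall x, thru P x -> exists c, P x (r c)) ->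
  exists M : profile 'I_n, [/\ refines M P, forall c d, M (r c) (r d) = Q c d &
    forall c, thru M (r c) = thru Q c].
Proof.
move=> rinj rthru rsurj.
pose E x y := P x y || [exists c, exists d, [&& P x (r c), Q c d & P y (r d)]].
pose T x := [exists c, P x (r c) && thru Q c].
have EP x y : reflect (P x y \/ exists c d, [/\ P x (r c), Q c d & P y (r d)]) (E x y).
  apply: (iffP orP) => -[]; try by left.
    by move=> /existsP[c /existsP[d /and3P[]]]; right; exists c, d.
  by move=> [c [d [h1 h2 h3]]]; right; apply/existsP; exists c; apply/existsP; exists d; apply/and3P.
have Esym x y : E x y -> E y x.
  move=> /EP[xy|[c [d [h1 h2 h3]]]]; apply/EP; first by left; rewrite profC.
  by right; exists d, c; split=> //; rewrite profC.
have Etrans x y z : E x y -> E y z -> E x z.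
  move=> /EP[xy|[c [d [h1 h2 h3]]]] /EP[yz|[c' [d' [h1' h2' h3']]]]; apply/EP.
  - by left; exact: prof_trans yz.
  - by right; exists c', d'; split=> //; exact: prof_trans h1'.
  - by right; exists c, d; split=> //; rewrite profC in yz; exact: prof_trans h3.
  have e : d = c' by apply: rinj; rewrite profC in h3; exact: prof_trans h1'.
  by right; exists c, d'; split=> //; rewrite e in h2; exact: prof_trans h2'.
have Eeq : equivalence_rel E.
  apply/equivalence_relP; split=> [x|x y xy z]; first by apply/EP; left; exact: profxx.
  by apply/idP/idP; apply: Etrans => //; exact: Esym.
have Th x y : E x y -> T x -> T y.
  move=> /EP[xy|[c [d [h1 h2 h3]]]] /existsP[e /andP[xe te]]; apply/existsP.
    by exists e; rewrite te -(prof_eq xy) xe.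
  exists d; rewrite h3 -(thruP h2) (_ : c = e) ?te //.
  by apply: rinj; rewrite -(prof_eq h1).
have TP x y : E x y -> T x = T y.
  by move=> xy; apply/idP/idP; apply: Th => //; exact: Esym.
exists (Profile Eeq TP); split=> [|c d|c].
- split=> [x y xy|x y|x]; first by apply/EP; left.
    case/EP=> [-> //|[c [d [h1 h2 h3]]]].
    by rewrite (thruP h1) (thruP h3) !rthru orbT.
  by case/existsP=> c /andP[xc _]; rewrite (thruP xc) rthru.
- apply/EP/idP => [[/rinj -> |[c' [d' [/rinj -> h /rinj ->]]]]|cd] //; first exact: profxx.
  by right; exists c, d; rewrite !profxx.
apply/existsP/idP => [[d /andP[/rinj <-]] //|tc].
by exists c; rewrite profxx.
Qed.

Variables (k l : nat) (p : cpart k k) (q : cpart l l).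
Hypotheses (pP : projective p) (qP : projective q).
Local Notation t1 := (nthrough p).
Local Notation t2 := (nthrough q).
Variables (pu : cpart k t1) (qu : cpart l t2).
Hypotheses (pu_up : is_upart pu) (qu_up : is_upart qu).

Local Notation P := (cat_prof (upper p) (upper q)).

Lemma upart_tensor : exists2 r : 'I_(t1 + t2) -> 'I_(k + l),
  [/\ forall c d, P (r c) (r d) -> c = d, forall c, thru P (r c),
    forall x, thru P x -> exists c, P x (r c) &
    (forall x, exists y, r (lshift t2 x) = lshift l y) /\
    (forall x, exists y, r (rshift t1 x) = rshift k y)] &
  encodes P id r (tensor pu qu) /\ encodes P r id (tensor (adj pu) (adj qu)).
Proof.
have [r1 [e1 i1 t1' s1] _] := is_upart_data pu_up.
have [r2 [e2 i2 t2' s2] _] := is_upart_data qu_up.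
have rl x : cat_map r1 r2 (lshift t2 x) = lshift l (r1 x) by rewrite /cat_map side_l.
have rr x : cat_map r1 r2 (rshift t1 x) = rshift k (r2 x) by rewrite /cat_map side_r.
exists (cat_map r1 r2); last first.
  split.
    by apply: encodes_eq_labels (encodes_tensor e1 e2) => //; exact: cat_map_id.
  by apply: encodes_eq_labels (encodes_tensor (encodes_adj e1) (encodes_adj e2)) => //; exact: cat_map_id.
split.
- elim/side_ind => c; elim/side_ind => d; rewrite ?rl ?rr ?catE //.
    by move/i1 ->.
  by move/i2 ->.
- by elim/side_ind => c; rewrite ?rl ?rr catE.
- elim/side_ind => x; rewrite catE.
    by case/s1=> c xc; exists (lshift t2 c); rewrite rl catE.
  by case/s2=> c xc; exists (rshift t1 c); rewrite rr catE.
by split=> x; [exists (r1 x) | exists (r2 x)].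
Qed.

Lemma color_glue (h : cpart (t1 + t2) (t1 + t2)) :
  color (comp (tensor (adj pu) (adj qu)) (comp h (tensor pu qu))) =1 color (tensor p q).
Proof.
have [r1 _ c1] := is_upart_data pu_up; have [r2 _ c2] := is_upart_data qu_up.
case; elim/side_ind => x; rewrite !color_comp ?color_tensor_l ?color_tensor_r ?side_l ?side_r;
  rewrite ?color_adj /=; by case: (c1 x) || case: (c2 x).
Qed.

Lemma encodes_glue r (h : cpart (t1 + t2) (t1 + t2)) (M : profile 'I_(k + l)) :
  refines M P -> (forall x, thru P x -> exists c, P x (r c)) ->
  encodes P id r (tensor pu qu) -> encodes P r id (tensor (adj pu) (adj qu)) ->
  encodes M r r h ->
  encodes M id id (comp (tensor (adj pu) (adj qu)) (comp h (tensor pu qu))).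
Proof.
move=> MP sur e e' Mh.
exact: encodes_comp_top MP sur (encodes_comp_bot MP sur e Mh) e'.
Qed.

Lemma balanced_glue h : balanced (comp (tensor (adj pu) (adj qu)) (comp h (tensor pu qu))).
Proof.
have [_ bp] := projective_encodes pP; have [_ bq] := projective_encodes qP.
by move=> x; rewrite !color_glue balanced_tensor.
Qed.

End Gluing.

(** From $m\in X$ the partition $h$ is read off on the representatives of the
through-blocks; a block of $h$ with one point is not cut, as [tight_tl] and
[tight_tr] would join it to a point of the other half. *)
Lemma X_eq_YC (C : forall k l, {set cpart k l}) (hC : category C) k l
    (p : cpart k k) (q : cpart l l) (pP : projective p) (qP : projective q) :
  X C p q = Y p q :&: C (k + l)%N (k + l)%N.
Proof.
have [Up bp] := projective_encodes pP; have [Uq bq] := projective_encodes qP.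
apply/setP => m; rewrite [in RHS]inE; apply/idP/andP => [mX|[]].
  have [t1 t2 t3 t4] := X_tight pP qP hC mX.
  move: mX; rewrite inE => /andP[mC /and4P[mP mpq _ _]]; split=> //.
  have [Um bm] := projective_encodes mP.
  have [uc rm] := elimT (preceq_tensorP Up bp Uq bq mP) mpq.
  have [pu pu_up] := is_upart_exists pP; have [qu qu_up] := is_upart_exists qP.
  have [r [ri rt rs [rl rr]] [eS eS']] := upart_tensor pu_up qu_up.
  pose h : cpart (nthrough p + nthrough q) (nthrough p + nthrough q) :=
    part_of_rel (level_rel_equivalence (label r r) (@lower _ _) (upper m)) [ffun=> false].
  have eh : encodes (upper m) r r h by move=> u v; rewrite linked_part_of_rel.
  have eh' : encodes (pull r (upper m)) id id h by move=> [x|x] [y|y]; rewrite eh.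
  rewrite inE; apply/existsP; exists pu; apply/existsP; exists qu; apply/existsP; exists h.
  rewrite pu_up qu_up /=; apply/andP; split; last first.
    apply/eqP/cpart_ext => [u v|u].
      by rewrite Um (encodes_glue rm rs eS eS' eh).
    rewrite (color_glue pu_up qu_up); apply: eq_ucol => //; exact: balanced_tensor.
  have [_ m2 _] := rm.
  apply: (mixed_mixing eh' erefl); split=> [a b|a b|c alone].
  - move=> ab; suff /lshift_inj : lshift (nthrough q) a = lshift (nthrough q) b by [].
    have [x xE] := rl a; have [y yE] := rl b; move: ab; rewrite /= => ab.
    by apply: ri; move: ab; rewrite xE yE catE; exact: t1.
  - move=> ab; suff /rshift_inj : rshift (nthrough p) a = rshift (nthrough p) b by [].
    have [x xE] := rr a; have [y yE] := rr b; move: ab; rewrite /= => ab.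
    by apply: ri; move: ab; rewrite xE yE catE; exact: t2.
  have := rt c; rewrite [thru (pull _ _) _]/=; move: c alone; elim/side_ind => c alone.
    have [x xE] := rl c; rewrite xE catE => /t3[//|[y xy]].
    have := m2 _ _ xy; rewrite !catE /= => /andP[_ ty].
    have [d yd] : exists d, cat_prof (upper p) (upper q) (rshift k y) (r d).
      by apply: rs; rewrite catE.
    have dc : d = lshift (nthrough q) c.
      apply: alone; rewrite /= xE; apply: prof_trans xy _; have [m1 _ _] := rm; exact: m1.
    by move: yd; rewrite dc xE catE.
  have [x xE] := rr c; rewrite xE catE => /t4[//|[y xy]].
  have := m2 _ _ xy; rewrite !catE /= => /andP[_ ty].
  have [d yd] : exists d, cat_prof (upper p) (upper q) (lshift l y) (r d).
    by apply: rs; rewrite catE.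
  have dc : d = rshift (nthrough p) c.
    apply: alone; rewrite /= xE; apply: prof_trans xy _; have [m1 _ _] := rm; exact: m1.
  by move: yd; rewrite dc xE catE.
rewrite inE => /existsP[pu /existsP[qu /existsP[h /and4P[pu_up qu_up hM /eqP em]]]] mC.
have [r [ri rt rs [rl rr]] [eS eS']] := upart_tensor pu_up qu_up.
have [h1 h2 h3] := mixing_mixed hM.
have [Uh bh] := projective_encodes (proj1 (andP hM)).
have [M [rM ME MT]] := glue_profile (upper h) ri rt rs.
have eh : encodes M r r h by move=> [x|x] [y|y]; rewrite Uh /level_rel /= ?ME ?MT.
have Um : encodes M id id m by rewrite em; exact: encodes_glue rM rs eS eS' eh.
have bm : balanced m by rewrite em; exact: balanced_glue.
have mP := encodes_projective Um bm.
have [eM tM] := encodes_id_upper Um.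
have [m1 m2 m3] := rM.
apply: tight_X => //.
  apply/(preceqP (encodes_tensor_id Up Uq) Um bm (balanced_tensor bp bq)); split=> //.
  by apply/ffunP => x; rewrite !ucolE em (color_glue pu_up qu_up).
have PM x c : cat_prof (upper p) (upper q) x (r c) -> M x (r c) by exact: m1.
have lcase x c : cat_prof (upper p) (upper q) (lshift l x) (r c) ->
    exists a, c = lshift (nthrough q) a.
  elim/side_ind: c => c; first by exists c.
  by have [y ->] := rr c; rewrite catE.
have rcase x c : cat_prof (upper p) (upper q) (rshift k x) (r c) ->
    exists a, c = rshift (nthrough p) a.
  elim/side_ind: c => c; last by exists c.
  by have [y ->] := rl c; rewrite catE.
split=> [x y|x y|x tx|x tx]; rewrite -?eM -?tM.
- move=> xy; have := m2 _ _ xy; rewrite !catE => /orP[//|/andP[tx ty]].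
  have [c xc] : exists c, cat_prof (upper p) (upper q) (lshift l x) (r c) by apply: rs; rewrite catE.
  have [d yd] : exists d, cat_prof (upper p) (upper q) (lshift l y) (r d) by apply: rs; rewrite catE.
  have [a ca] := lcase _ _ xc; have [b db] := lcase _ _ yd.
  have cd : M (r c) (r d).
    by rewrite -(prof_eq (PM _ _ xc)) (prof_eq xy); exact: PM.
  move: cd; rewrite ME ca db => /h1 ab; rewrite -(cat_ll _ (upper q)) (prof_eq xc) profC.
  by rewrite ca ab -db.
- move=> xy; have := m2 _ _ xy; rewrite !catE => /orP[//|/andP[tx ty]].
  have [c xc] : exists c, cat_prof (upper p) (upper q) (rshift k x) (r c) by apply: rs; rewrite catE.
  have [d yd] : exists d, cat_prof (upper p) (upper q) (rshift k y) (r d) by apply: rs; rewrite catE.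
  have [a ca] := rcase _ _ xc; have [b db] := rcase _ _ yd.
  have cd : M (r c) (r d).
    by rewrite -(prof_eq (PM _ _ xc)) (prof_eq xy); exact: PM.
  move: cd; rewrite ME ca db => /h2 ab; rewrite -(cat_rr (upper p)) (prof_eq xc) profC.
  by rewrite ca ab -db.
- have [c xc] : exists c, cat_prof (upper p) (upper q) (lshift l x) (r c) by apply: rs; rewrite catE.
  have [a ca] := lcase _ _ xc.
  have [alone|] := pselect (forall d, upper h c d -> d = c).
    by left; rewrite (thruP (PM _ _ xc)) MT; exact: h3.
  move/existsNP=> [d /not_implyP[cd dc]]; right.
  move: cd dc; elim/side_ind: d => d cd dc; first by case: dc; rewrite ca in cd *; rewrite (h1 _ _ cd).
  have [y yd] := rr d; exists y; rewrite -eM -yd; apply: prof_trans (PM _ _ xc) _.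
  by rewrite ME.
have [c xc] : exists c, cat_prof (upper p) (upper q) (rshift k x) (r c) by apply: rs; rewrite catE.
have [a ca] := rcase _ _ xc.
have [alone|] := pselect (forall d, upper h c d -> d = c).
  by left; rewrite (thruP (PM _ _ xc)) MT; exact: h3.
move/existsNP=> [d /not_implyP[cd dc]]; right.
move: cd dc; elim/side_ind: d => d cd dc; last by case: dc; rewrite ca in cd *; rewrite (h2 _ _ cd).
have [y yd] := rl d; exists y; rewrite -eM -yd; apply: prof_trans (PM _ _ xc) _.
by rewrite ME.
Qed.

(** * Operators and their matrix coefficients *)

Import Order.TTheory GRing.Theory Num.Theory.
Local Open Scope ring_scope.

Section Coef.
Variable R : realType.
Local Notation C := R[i].
Local Notation fspace := (fspace R).
Implicit Types I J K : finType.

(* [op] applies [linfun] to a function; it computes only once that function is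
   known to be linear. *)
Section OpLinear.
Variables (I J : finType) (a : J -> I -> C).
Definition opfun (v : fspace I) : fspace J := [ffun j => \sum_i a j i * v i].
Lemma opfun_linear : linear opfun.
Proof.
move=> c u v; apply/ffunP => j; rewrite !ffunE scaler_sumr -big_split.
by apply: eq_bigr => i _; rewrite !ffunE mulrDr mulrCA.
Qed.
HB.instance Definition _ := GRing.isLinear.Build C (fspace I) (fspace J) _ opfun opfun_linear.
End OpLinear.

Lemma fspace_basis I (v : fspace I) : v = \sum_i v i *: basis R i.
Proof.
apply/ffunP => j; rewrite sum_ffunE (bigD1 j) //= big1 => [|i ij]; last first.
  by rewrite !ffunE (negPf ij) scaler0.
by rewrite addr0 !ffunE eqxx [_ *: _]mulr1.
Qed.

Lemma lcoefP I J (T : 'Hom(fspace I, fspace J)) v j : T v j = \sum_i coef T j i * v i.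
Proof.
rewrite {1}[v]fspace_basis linear_sum sum_ffunE; apply: eq_bigr => i _.
by rewrite linearZ ffunE /= mulrC.
Qed.

Lemma lcoef_inj I J (S T : 'Hom(fspace I, fspace J)) :
  (forall j i, coef S j i = coef T j i) -> S = T.
Proof.
move=> e; apply/lfunP => v; apply/ffunP => j; rewrite !lcoefP.
by apply: eq_bigr => i _; rewrite e.
Qed.

Lemma lcoef_op I J (a : J -> I -> C) j i : coef (op a) j i = a j i.
Proof.
rewrite /coef /op (_ : (fun v : fspace I => _) = opfun a) // lfunE /= ffunE.
rewrite (bigD1 i) //= big1 => [|i' ii']; last by rewrite ffunE eq_sym (negPf ii') mulr0.
by rewrite addr0 ffunE eqxx mulr1.
Qed.

Lemma lcoef_comp I J K (S : 'Hom(fspace J, fspace K)) (T : 'Hom(fspace I, fspace J)) k i :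
  coef (S \o T)%VF k i = \sum_j coef S k j * coef T j i.
Proof. by rewrite /coef comp_lfunE lcoefP. Qed.

Lemma lcoefD I J (S T : 'Hom(fspace I, fspace J)) j i : coef (S + T) j i = coef S j i + coef T j i.
Proof. by rewrite /coef add_lfunE ffunE. Qed.

Lemma lcoefN I J (T : 'Hom(fspace I, fspace J)) j i : coef (- T) j i = - coef T j i.
Proof. by rewrite /coef opp_lfunE ffunE. Qed.

Lemma lcoefZ I J c (T : 'Hom(fspace I, fspace J)) j i : coef (c *: T) j i = c * coef T j i.
Proof. by rewrite /coef scale_lfunE ffunE. Qed.

Lemma lcoef0 I J j i : coef (0 : 'Hom(fspace I, fspace J)) j i = 0.
Proof. by rewrite /coef zero_lfunE ffunE. Qed.

Lemma lcoef1 I (j i : I) : coef (\1%VF : 'End(fspace I)) j i = (i == j)%:R.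
Proof. by rewrite /coef id_lfunE ffunE. Qed.

Lemma lcoef_sum I J (K : finType) (D : pred K) (T : K -> 'Hom(fspace I, fspace J)) j i :
  coef (\sum_(q | D q) T q) j i = \sum_(q | D q) coef (T q) j i.
Proof. by rewrite /coef sum_lfunE sum_ffunE. Qed.

Lemma lcoef_adj I J (T : 'Hom(fspace I, fspace J)) i j : coef (adjop T) i j = (coef T j i)^*.
Proof. exact: lcoef_op. Qed.

Definition lcoefE := (lcoefD, lcoefN, lcoefZ, lcoef0, lcoef_adj).

Lemma adjopK I J (T : 'Hom(fspace I, fspace J)) : adjop (adjop T) = T.
Proof. by apply: lcoef_inj => j i; rewrite !lcoefE conjCK. Qed.

Lemma adjop_comp I J K (S : 'Hom(fspace J, fspace K)) (T : 'Hom(fspace I, fspace J)) :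
  adjop (S \o T)%VF = (adjop T \o adjop S)%VF.
Proof.
apply: lcoef_inj => i k; rewrite lcoef_adj !lcoef_comp rmorph_sum.
by apply: eq_bigr => j _; rewrite rmorphM !lcoef_adj mulrC.
Qed.

Lemma adjopB I J (S T : 'Hom(fspace I, fspace J)) : adjop (S - T) = adjop S - adjop T.
Proof. by apply: lcoef_inj => i j; rewrite !lcoefE rmorphB. Qed.

Lemma adjop0 I J : adjop (0 : 'Hom(fspace I, fspace J)) = 0.
Proof. by apply: lcoef_inj => i j; rewrite !lcoefE conjC0. Qed.

Lemma adjop1 I : adjop (\1%VF : 'End(fspace I)) = \1%VF.
Proof. by apply: lcoef_inj => i j; rewrite !lcoefE !lcoef1 conjC_nat eq_sym. Qed.

Lemma adjop_sum I J (K : finType) (D : pred K) (T : K -> 'Hom(fspace I, fspace J)) :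
  adjop (\sum_(q | D q) T q) = \sum_(q | D q) adjop (T q).
Proof.
by apply: lcoef_inj => i j; rewrite lcoef_adj !lcoef_sum rmorph_sum; apply: eq_bigr => q _; rewrite lcoef_adj.
Qed.

Lemma lcoef_gram I J (T : 'Hom(fspace I, fspace J)) i :
  coef (adjop T \o T)%VF i i = \sum_j `|coef T j i| ^+ 2.
Proof. by rewrite lcoef_comp; apply: eq_bigr => j _; rewrite lcoef_adj normCK mulrC. Qed.

(** The diagonal coefficients of a sum of $T_q^*T_q$ are sums of squared moduli. *)
Lemma gram_sum_eq0 I J (K : finType) (D : pred K) (T : K -> 'Hom(fspace I, fspace J)) :
  \sum_(q | D q) (adjop (T q) \o T q)%VF = 0 -> forall q, D q -> T q = 0.
Proof.
move=> s0 q Dq; apply: lcoef_inj => j i; rewrite lcoef0.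
have : coef (\sum_(q | D q) (adjop (T q) \o T q)%VF) i i = 0 by rewrite s0 lcoef0.
rewrite lcoef_sum => /eqP; rewrite psumr_eq0 => [/allP/(_ q)|r _]; last first.
  by rewrite lcoef_gram; apply: sumr_ge0 => r' _; rewrite exprn_ge0.
rewrite mem_index_enum Dq => /(_ isT) /=; rewrite lcoef_gram psumr_eq0 => [/allP/(_ j)|r _]; last first.
  by rewrite exprn_ge0.
by rewrite mem_index_enum => /(_ isT) /=; rewrite expf_eq0 normr_eq0 => /eqP.
Qed.

Lemma gram_eq0 I J (T : 'Hom(fspace I, fspace J)) : (adjop T \o T)%VF = 0 -> T = 0.
Proof.
move=> h; apply: (@gram_sum_eq0 _ _ 'I_1 predT (fun=> T) _ ord0) => //.
by rewrite big_ord1.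
Qed.

Lemma ginv I J (T : 'Hom(fspace I, fspace J)) : (T \o (T^-1 \o T))%VF = T.
Proof. by rewrite comp_lfunA inv_lfun_def. Qed.

(* the orthogonal projection onto the range of a self-adjoint operator *)
(** With $G$ a generalized inverse of $A^2$, the operator $F=AGA$ is the projection
onto the range of $A$. For $D=FA-A$ one has $AD=0$ by the choice of $G$, and $D$
has the form $AZ$, so $D^*D=Z^*AD=0$ and $FA=A$. Then $F^*=AG^*A$ gives
$FF^*=F^*$, so $F$ is a self-adjoint idempotent. The factor [B] records that $F$
is a right multiple of $A$. *)
Lemma range_proj I (A : 'End(fspace I)) : adjop A = A ->
  exists B, let F := (A \o B)%VF in is_proj F /\ (F \o A)%VF = A.
Proof.
move=> sA; pose B := (((A \o A)^-1) \o A)%VF; exists B; set F := (A \o B)%VF => /=.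
have FA : (F \o A)%VF = A.
  apply/eqP; rewrite -subr_eq0; apply/eqP/gram_eq0.
  have AD : (A \o (F \o A - A))%VF = 0.
    rewrite comp_lfunDr comp_lfunNr.
    by rewrite /F /B -!comp_lfunA [X in X - _]comp_lfunA ginv subrr.
  have -> : (F \o A - A)%VF = (A \o (B \o A - \1))%VF.
    by rewrite /F /B -!comp_lfunA comp_lfunDr comp_lfunNr comp_lfun1r.
  rewrite adjop_comp sA -comp_lfunA.
  have -> : (A \o (A \o (B \o A - \1)))%VF = (A \o (F \o A - A))%VF.
    by rewrite [(A \o (B \o A - \1))%VF]comp_lfunDr comp_lfunNr comp_lfun1r /F comp_lfunA.
  by rewrite AD comp_lfun0r.
split=> //.
have FF : (F \o adjop F)%VF = adjop F.
  have -> : adjop F = (A \o (adjop (A \o A)^-1 \o A))%VF.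
    by rewrite /F /B !adjop_comp sA -comp_lfunA.
  by rewrite comp_lfunA FA.
have sF : adjop F = F by rewrite -[RHS]adjopK -FF adjop_comp adjopK FF.
by split=> //; rewrite -{2}sF FF sF.
Qed.
End Coef.

(** * Projections among intertwiners *)

Section Projections.
Variable R : realType.
Local Notation fspace := (fspace R).
Variable I : finType.
Implicit Types P Q S T : 'End(fspace I).

Lemma proj_le_sym P Q : is_proj P -> is_proj Q -> le_proj P Q -> (P \o Q)%VF = P.
Proof. by move=> [_ sP] [_ sQ] PQ; rewrite -{1}sP -{1}sQ -adjop_comp PQ. Qed.

Lemma is_projB P Q : is_proj P -> is_proj Q -> le_proj P Q -> is_proj (Q - P).
Proof.
move=> pP pQ PQ; have PQ' := proj_le_sym pP pQ PQ; case: pP pQ => pp sP [qq sQ].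
split; last by rewrite adjopB sP sQ.
rewrite comp_lfunDl comp_lfunNl !comp_lfunDr !comp_lfunNr.
by rewrite pp qq PQ PQ' subrr subr0.
Qed.

Lemma comp_lfun_sum_l (K : finType) (D : pred K) (T : K -> 'End(fspace I)) S :
  ((\sum_(q | D q) T q) \o S)%VF = \sum_(q | D q) (T q \o S)%VF.
Proof.
by apply/lfunP => v; rewrite comp_lfunE !sum_lfunE; apply: eq_bigr => q _; rewrite comp_lfunE.
Qed.

Lemma comp_lfun_sum_r (K : finType) (D : pred K) (T : K -> 'End(fspace I)) S :
  (S \o (\sum_(q | D q) T q))%VF = \sum_(q | D q) (S \o T q)%VF.
Proof.
apply/lfunP => v; rewrite comp_lfunE !sum_lfunE linear_sum.
by apply: eq_bigr => q _; rewrite comp_lfunE.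
Qed.

Lemma is_proj1 : is_proj (\1%VF : 'End(fspace I)).
Proof. by split; [rewrite comp_lfun1r | exact: adjop1]. Qed.

End Projections.

Section Intertwiners.
Variables (R : realType) (A : cstarAlg R).
Local Notation C := R[i].
Local Notation fspace := (fspace R).
Implicit Types I J K L : finType.

Lemma lact_comp I J K L (S : 'Hom(fspace J, fspace K)) (T : 'Hom(fspace I, fspace J))
    (x : I -> L -> A) : lact (S \o T)%VF x = lact S (lact T x).
Proof.
apply/funext => k; apply/funext => m; rewrite /lact.
under eq_bigr do rewrite lcoef_comp scaler_suml.
rewrite exchange_big /=; apply: eq_bigr => j _; rewrite scaler_sumr.
by apply: eq_bigr => i _; rewrite scalerA.
Qed.

Lemma ract_comp I J K L (S : 'Hom(fspace J, fspace K)) (T : 'Hom(fspace I, fspace J))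
    (x : L -> K -> A) : ract x (S \o T)%VF = ract (ract x S) T.
Proof.
apply/funext => k; apply/funext => i; rewrite /ract.
under eq_bigr do rewrite lcoef_comp scaler_suml.
rewrite exchange_big /=; apply: eq_bigr => j _; rewrite scaler_sumr.
by apply: eq_bigr => h _; rewrite scalerA mulrC.
Qed.

Lemma lact_ract I J K L (S : 'Hom(fspace J, fspace K)) (T : 'Hom(fspace I, fspace L))
    (x : J -> L -> A) : lact S (ract x T) = ract (lact S x) T.
Proof.
apply/funext => k; apply/funext => i; rewrite /ract /lact.
under eq_bigr do rewrite scaler_sumr.
rewrite exchange_big /=; apply: eq_bigr => j _; rewrite scaler_sumr.
by apply: eq_bigr => h _; rewrite !scalerA mulrC.
Qed.

Lemma lact_lin I J L c (S T : 'Hom(fspace I, fspace J)) (x : I -> L -> A) k m :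
  lact (c *: S + T) x k m = c *: lact S x k m + lact T x k m.
Proof.
rewrite /lact scaler_sumr -big_split; apply: eq_bigr => j _ /=.
by rewrite !lcoefE scalerDl scalerA.
Qed.

Lemma ract_lin I J L c (S T : 'Hom(fspace I, fspace J)) (x : L -> J -> A) k m :
  ract x (c *: S + T) k m = c *: ract x S k m + ract x T k m.
Proof.
rewrite /ract scaler_sumr -big_split; apply: eq_bigr => j _ /=.
by rewrite !lcoefE scalerDl scalerA.
Qed.

Variables (I : finType) (x : I -> I -> A).
Local Notation H := (intertwiners x x).

Lemma intw_lin c S T : H S -> H T -> H (c *: S + T).
Proof.
move=> hS hT; apply/funext => k; apply/funext => m; rewrite lact_lin ract_lin.
by rewrite -[lact S x]/(lact S x) hS hT.
Qed.

Lemma intw1 : H \1%VF.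
Proof.
apply/funext => k; apply/funext => m; rewrite /lact /ract (bigD1 k) //= [in RHS](bigD1 m) //=.
rewrite !lcoef1 !eqxx; congr (_ + _); rewrite !big1 // => j jk; rewrite lcoef1.
  by rewrite eq_sym (negPf jk) scale0r.
by rewrite (negPf jk) scale0r.
Qed.

Lemma intwB S T : H S -> H T -> H (S - T).
Proof. by move=> hS hT; rewrite addrC -scaleN1r; exact: intw_lin. Qed.

Lemma intw_sum (K : finType) (D : pred K) (T : K -> 'End(fspace I)) :
  (forall q, D q -> H (T q)) -> H (\sum_(q | D q) T q).
Proof.
move=> hT; apply: (big_ind (fun S => H S)) => //.
  by rewrite -(subrr \1%VF); exact: intwB intw1 intw1.
by move=> S T' hS hT'; rewrite -[S]scale1r; exact: intw_lin.
Qed.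

(** The supremum is the projection $F$ onto the range of $a=\sum_q t_q$. From $Fa=a$,
$\sum_q(t_q(1-F))^*(t_q(1-F))=(1-F)a(1-F)=0$, so that $Ft_q=t_q$ for all $q$.
Since $F=ab=b^*a$ and $a$ intertwines, both $Fx$ and $xF$ are equal to $FxF$
(matrices over the algebra), so $F$ intertwines. *)
Lemma sup_projP (K : finType) (D : pred K) (t : K -> 'End(fspace I)) (S : set 'End(fspace I)) :
  (forall q, D q -> H (t q) /\ is_proj (t q)) -> S = [set T | exists2 q, D q & T = t q]%classic ->
  is_sup_proj H S (sup_proj H S).
Proof.
move=> ht ->; apply: xgetPex.
pose a := \sum_(q | D q) t q.
have sa : adjop a = a.
  by rewrite adjop_sum; apply: eq_bigr => q Dq; have [_ []] := ht q Dq.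
have ha : H a by apply: intw_sum => q /ht[].
have [b /= [pF Fa]] := range_proj sa; set F := (a \o b)%VF in pF Fa.
have [FF sF] := pF.
have aF : (a \o F)%VF = a by rewrite -{1}sa -{1}sF -adjop_comp Fa sa.
have Ft q : D q -> (F \o t q)%VF = t q.
  move=> Dq; have [_ [tt st]] := ht q Dq.
  have tF : (t q \o (\1 - F))%VF = 0.
    apply: (gram_sum_eq0 (D := D) (T := fun r => (t r \o (\1 - F))%VF)) => //.
    transitivity ((\1 - F) \o (a \o (\1 - F)))%VF.
      rewrite comp_lfun_sum_l comp_lfun_sum_r; apply: eq_bigr => r Dr.
      have [_ [tr sr]] := ht r Dr.
      by rewrite adjop_comp adjopB adjop1 sF sr -comp_lfunA [(t r \o (t r \o _))%VF]comp_lfunA tr.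
    by rewrite comp_lfunA comp_lfunDl comp_lfunNl comp_lfun1l Fa subrr comp_lfun0l.
  have: adjop (t q \o (\1 - F))%VF = 0 by rewrite tF adjop0.
  rewrite adjop_comp adjopB adjop1 sF st comp_lfunDl comp_lfunNl comp_lfun1l => /eqP.
  by rewrite subr_eq0 => /eqP <-.
exists F; split=> //.
- have h1 : lact F (ract x F) = ract x F.
    by rewrite {2 3}/F ract_comp -ha lact_ract -lact_comp Fa ha.
  have h2 : ract (lact F x) F = lact F x.
    have -> : lact F x = lact (adjop b) (ract x a).
      by rewrite -{1}sF adjop_comp sa lact_comp ha.
    by rewrite -lact_ract -ract_comp aF.
  by rewrite /intertwiners /= -h2 -lact_ract h1.
- by move=> T [q Dq ->]; exact: Ft.
move=> Q' hQ' pQ' tQ'; rewrite /le_proj /F comp_lfunA comp_lfun_sum_r.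
congr (_ \o _)%VF; apply: eq_bigr => q Dq; apply: tQ'; by exists q.
Qed.

End Intertwiners.

(** * Tensor products of operators *)

Section Midx.
Variables (R : realType) (N : nat).
Local Notation C := R[i].
Local Notation fspace := (fspace R).

Definition join_idx k l (a : midx N k) (b : midx N l) : midx N (k + l) := [ffun i => side a b i].

Lemma lidx_join k l (a : midx N k) (b : midx N l) : lidx (join_idx a b) = a.
Proof. by apply/ffunP => i; rewrite !ffunE side_l. Qed.

Lemma ridx_join k l (a : midx N k) (b : midx N l) : ridx (join_idx a b) = b.
Proof. by apply/ffunP => i; rewrite !ffunE side_r. Qed.

Lemma join_idxK k l (i : midx N (k + l)) : join_idx (lidx i) (ridx i) = i.
Proof. by apply/ffunP; elim/side_ind => x; rewrite !ffunE ?side_l ?side_r ffunE. Qed.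

Lemma sum_midx (V : nmodType) k l (F : midx N k -> midx N l -> V) :
  \sum_(i : midx N (k + l)) F (lidx i) (ridx i) = \sum_a \sum_b F a b.
Proof.
rewrite pair_big /=; rewrite (reindex (fun ab : midx N k * midx N l => join_idx ab.1 ab.2)) /=.
  by apply: eq_bigr => -[a b] _; rewrite lidx_join ridx_join.
exists (fun i => (lidx i, ridx i)) => [[a b] _|i _] /=; last exact: join_idxK.
by rewrite lidx_join ridx_join.
Qed.

Variables k l : nat.
Implicit Types (S : 'End(fspace (midx N k))) (T : 'End(fspace (midx N l))).

Lemma lcoef_tensor S T j i :
  coef (tensor_op S T) j i = coef S (lidx j) (lidx i) * coef T (ridx j) (ridx i).
Proof. exact: lcoef_op. Qed.

Lemma tensor_op_comp S S' T T' :
  (tensor_op S T \o tensor_op S' T')%VF = tensor_op (S \o S')%VF (T \o T')%VF.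
Proof.
apply: lcoef_inj => j i; rewrite lcoef_comp lcoef_tensor !lcoef_comp.
under eq_bigr do rewrite !lcoef_tensor.
rewrite (sum_midx (fun a b => coef S (lidx j) a * coef T (ridx j) b *
   (coef S' a (lidx i) * coef T' b (ridx i)))) big_distrlr /=.
by apply: eq_bigr => a _; apply: eq_bigr => b _; rewrite mulrACA.
Qed.

Lemma tensor_op_adj S T : adjop (tensor_op S T) = tensor_op (adjop S) (adjop T).
Proof. by apply: lcoef_inj => j i; rewrite !lcoefE !lcoef_tensor !lcoefE rmorphM. Qed.

Lemma tensor_op0l T : tensor_op (0 : 'End(fspace (midx N k))) T = 0.
Proof. by apply: lcoef_inj => j i; rewrite lcoef_tensor !lcoef0 mul0r. Qed.

Lemma tensor_op0r S : tensor_op S (0 : 'End(fspace (midx N l))) = 0.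
Proof. by apply: lcoef_inj => j i; rewrite lcoef_tensor !lcoef0 mulr0. Qed.

Lemma is_proj_tensor S T : is_proj S -> is_proj T -> is_proj (tensor_op S T).
Proof. by move=> [ss sS] [tt sT]; split; rewrite ?tensor_op_comp ?tensor_op_adj ?ss ?tt ?sS ?sT. Qed.

End Midx.

(** * The maps $T_p$ of projective partitions *)

Section Delta.
Variable N : nat.

Lemma deltaP k (P : profile 'I_k) (p : cpart k k) (i j : midx N k) : encodes P id id p ->
  reflect [/\ forall x y, P x y -> i x = i y, forall x y, P x y -> j x = j y &
              forall x, thru P x -> i x = j x] (delta p i j).
Proof.
move=> Pp; apply: (iffP forallP) => [h|[hi hj hij] u].
  have lab u v : linked p u v -> label i j u = label i j v.
    by move=> uv; have /forallP/(_ v) := h u; rewrite uv => /eqP; case: u v {uv} => u [] v.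
  split=> [x y xy|x y xy|x tx].
  - by apply: (lab (inl x) (inl y)); rewrite Pp /level_rel /= xy orbT.
  - by apply: (lab (inr x) (inr y)); rewrite Pp /level_rel /= xy orbT.
  by apply: (lab (inl x) (inr x)); rewrite Pp /level_rel /= profxx tx.
apply/forallP => v; apply/implyP; rewrite Pp.
case: u v => u [] v /andP[/= uv]; rewrite ?orbF ?orbT => tu; apply/eqP.
- exact: hi.
- by rewrite (hij _ tu); exact: hj.
- by rewrite -(hi _ _ uv) (hij _ tu).
exact: hj.
Qed.

Lemma deltaC k (P : profile 'I_k) (p : cpart k k) (i j : midx N k) : encodes P id id p ->
  delta p i j = delta p j i.
Proof.
move=> Pp; apply/(deltaP _ _ Pp)/(deltaP _ _ Pp) => -[h1 h2 h3]; split=> // x tx; by rewrite h3.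
Qed.

Lemma through_pblock k (P : profile 'I_k) (p : cpart k k) u : encodes P id id p ->
  through (pblock (blocks p) u) = thru P (label id id u).
Proof.
move=> Pp; apply/andP/idP => [[/existsP[x]]|tu].
  rewrite -/(linked p u (inl x)) Pp => /andP[ux tx] /existsP[y].
  rewrite -/(linked p u (inr y)) Pp => /andP[uy].
  by case/orP: tx => // /eqP ->; rewrite orbF.
by split; apply/existsP; exists (label id id u); rewrite -/(linked p u _) Pp /level_rel /= profxx tu.
Qed.

(** The labels of the lower row being fixed, those of the upper row are free on the
non-through upper blocks. A pair of such labellings, one for each row, is a free
choice of a label on each of the [nother p] non-through blocks. *)
Lemma card_fiber k (P : profile 'I_k) (p : cpart k k) (j : midx N k) :
  encodes P id id p -> delta p j j ->
  (#|[set s | delta p s j]| ^ 2 = N ^ nother p)%N.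
Proof.
move=> Pp; move=> jj; have [_ jc _] := deltaP _ _ Pp jj.
set A := [set s | delta p s j].
pose D := {B : {set pt k k} | (B \in blocks p) && ~~ through B}.
have AP (s : midx N k) : reflect ((forall x y, P x y -> s x = s y) /\ (forall x, thru P x -> s x = j x)) (s \in A).
  by rewrite inE; apply: (iffP (deltaP _ _ Pp)) => [[]|[]].
pose Phi (g : {ffun D -> 'I_N}) (u : pt k k) : 'I_N :=
  if insub (pblock (blocks p) u) is Some B then g B else j (label id id u).
pose Psi g : midx N k * midx N k := ([ffun x => Phi g (inl x)], [ffun x => Phi g (inr x)]).
have pbm u : pblock (blocks p) u \in blocks p.
  by apply: finset.pblock_mem; rewrite (finset.cover_partition (cpartP p)) inE.
have tr := finset.partition_trivIset (cpartP p).
have PhiT g u : thru P (label id id u) -> Phi g u = j (label id id u).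
  move=> tu; rewrite /Phi; case: insubP => // B /andP[_].
  by rewrite (through_pblock u Pp) tu.
have PhiL g u v : linked p u v -> Phi g u = Phi g v.
  move=> uv; rewrite /Phi (finset.same_pblock tr uv); case: insubP => // _.
  by apply: jc; move: uv; rewrite Pp => /andP[].
have Psi_inj : injective Psi.
  move=> g g' [/ffunP e1 /ffunP e2]; apply/ffunP => B.
  have eu u : Phi g u = Phi g' u.
    by case: u => u; [have := e1 u|have := e2 u]; rewrite !ffunE.
  have /andP[BP nB] := valP B.
  have [u uB] : exists u, u \in val B.
    by apply/set0Pn; apply: contraTneq BP => ->; have /and3P[] := cpartP p.
  by have := eu u; rewrite /Phi (finset.def_pblock tr BP uB) valK.
have imP : Psi @: [set: {ffun D -> 'I_N}] = finset.setX A A.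
  apply/setP => -[s s']; rewrite finset.in_setX; apply/imsetP/andP => [[g _ [-> ->]]|[/AP[s1 s2] /AP[s1' s2']]].
    split; apply/AP; split=> [x y xy|x tx]; rewrite !ffunE.
    - by apply: PhiL; rewrite Pp /level_rel /= xy orbT.
    - exact: PhiT.
    - by apply: PhiL; rewrite Pp /level_rel /= xy orbT.
    exact: PhiT.
  have pick (B : D) : exists u, u \in val B.
    have /andP[BP _] := valP B.
    by apply/set0Pn; apply: contraTneq BP => ->; have /and3P[] := cpartP p.
  pose c (B : D) := xchoose (pick B).
  exists [ffun B => label s s' (c B)] => //.
  suff e u : Phi [ffun B => label s s' (c B)] u = label s s' u.
    by congr pair; apply/ffunP => x; rewrite ffunE e.
  rewrite /Phi; case: insubP => [B /andP[_ nB] eB|].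
    rewrite ffunE; have cB : c B \in val B := xchooseP (pick B).
    rewrite eB -/(linked p u (c B)) Pp (through_pblock u Pp) in nB cB.
    case/andP: cB; rewrite (negPf nB) /=; case: (u) (c B) => x [] y //= xy _; apply/esym.
      exact: s1.
    exact: s1'.
  rewrite pbm negbK (through_pblock u Pp); case: u => x /= tx; apply/esym.
    exact: s2.
  exact: s2'.
rewrite -mulnn -finset.cardsX -imP card_imset // cardsT card_ffun card_ord; congr (_ ^ _)%N.
rewrite card_sig /nother; apply: eq_card => B; by rewrite !inE.
Qed.

End Delta.

Section Tmaps.
Variables (R : realType) (N : nat).
Local Notation C := R[i].
Local Notation T p := (Tmap R N p).

Definition weight k l (p : cpart k l) : C := (sqrtC N%:R) ^- nother p.

Lemma lcoef_Tmap k l (p : cpart k l) j i :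
  coef (T p) j i = weight p * (delta p i j)%:R.
Proof. by rewrite /Tmap lcoefZ lcoef_op. Qed.

Lemma coef_Tmap_mul k (p m : cpart k k) i j s :
  coef (T p) j s * coef (T m) s i =
  weight m * (weight p * ((delta p s j)%:R * (delta m i s)%:R)).
Proof.
transitivity (weight p * (delta p s j)%:R * (weight m * (delta m i s)%:R)).
  by congr (_ * _); exact: lcoef_Tmap.
by rewrite mulrACA -mulrA mulrCA.
Qed.

Hypothesis hN : (0 < N)%N.

Lemma weight_gt0 k l (p : cpart k l) : 0 < weight p.
Proof. by rewrite invr_gt0 exprn_gt0 // sqrtC_gt0 ltr0n. Qed.

(** This is what the normalization $N^{-\beta(p)/2}$ is for. *)
Lemma weight_fiber k (P : profile 'I_k) (p : cpart k k) (j : midx N k) :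
  encodes P id id p -> delta p j j -> weight p * #|[set s | delta p s j]|%:R = 1.
Proof.
move=> Pp jj; rewrite /weight; set n := #|_|.
have -> : n%:R = (sqrtC N%:R) ^+ nother p :> C.
  apply/eqP; rewrite -(eqrXn2 (n := 2)) ?ler0n //; last first.
    by rewrite exprn_ge0 // sqrtC_ge0 ler0n.
  by rewrite -natrX (card_fiber Pp jj) exprAC sqrtCK natrX.
by rewrite mulVf // expf_neq0 // sqrtC_eq0 pnatr_eq0 -lt0n.
Qed.

(** In $T_pT_m$ a middle labelling $s$ contributes when it is compatible with both
partitions; given compatibility with [p], the labels $s$ and $j$ may be exchanged
in [m], which sees them through the classes of [p] only. So the sum is
[delta m i j] times the size of a fiber. *)
Lemma Tmap_le k (P P' : profile 'I_k) (p m : cpart k k) :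
  encodes P id id p -> encodes P' id id m -> refines P' P -> le_proj (T m) (T p).
Proof.
move=> Pp Pm [r1 r2 r3]; apply: lcoef_inj => j i; rewrite lcoef_comp.
transitivity (\sum_s weight m * (weight p * ((delta p s j)%:R * (delta m i s)%:R))).
  apply: eq_bigr => s _; exact: coef_Tmap_mul.
rewrite -mulr_sumr lcoef_Tmap //; congr (_ * _); rewrite -mulr_sumr.
under eq_bigr do rewrite -natrM mulnb.
have key s : delta p s j -> delta m i s = delta m i j.
  move=> /(deltaP _ _ Pp)[s1 j1 sj].
  apply/(deltaP _ _ Pm)/(deltaP _ _ Pm) => -[i1 c1 c2]; split=> // [x y xy|x tx].
  - by case/orP: (r2 _ _ xy) => [/j1 //|/andP[tx ty]]; rewrite -!sj //; exact: c1.
  - by rewrite c2 // sj // r3.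
  - by case/orP: (r2 _ _ xy) => [/s1 //|/andP[tx ty]]; rewrite !sj //; exact: c1.
  by rewrite c2 // sj // r3.
under eq_bigr => s _.
  rewrite (_ : _ && _ = delta m i j && delta p s j); last first.
    by case: (boolP (delta p s j)) => [/key ->|_]; rewrite ?andbT ?andbF.
  over.
case: (boolP (delta m i j)) => dm /=; last by rewrite big1 ?mulr0.
rewrite -natr_sum -big_mkcond /= sum1_card.
have jj : delta p j j.
  have [_ j1 _] := deltaP _ _ Pm dm.
  by apply/(deltaP _ _ Pp); split=> // x y /r1 /j1.
rewrite -[RHS](weight_fiber Pp jj) cardsE; congr (_ * _%:R); exact: eq_card.
Qed.

Lemma Tmap_proj k (P : profile 'I_k) (p : cpart k k) : encodes P id id p -> is_proj (T p).
Proof.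
move=> Pp; split; first exact: (Tmap_le Pp Pp (refines_refl P)).
apply: lcoef_inj => j i; rewrite lcoef_adj !lcoef_Tmap // (deltaC _ _ Pp) rmorphM rmorph_nat.
by congr (_ * _); apply/CrealP; rewrite realE ltW ?weight_gt0.
Qed.

(** Both sides are nonzero multiples of one 0-1 matrix, and both are idempotent, so
the factor is 1. *)
Lemma Tmap_tensor k l (P : profile 'I_k) (Q : profile 'I_l) p q :
  encodes P id id p -> encodes Q id id q -> T (tensor p q) = tensor_op (T p) (T q).
Proof.
move=> Pp Qq; have PQ := encodes_tensor_id Pp Qq.
have dE (i j : midx N (k + l)) : delta (tensor p q) i j =
    delta p (lidx i) (lidx j) && delta q (ridx i) (ridx j).
  apply/(deltaP _ _ PQ)/andP => [[h1 h2 h3]|[/(deltaP _ _ Pp)[h1 h2 h3] /(deltaP _ _ Qq)[h1' h2' h3']]].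
    split; [apply/(deltaP _ _ Pp)|apply/(deltaP _ _ Qq)]; split=> [x y xy|x y xy|x tx];
      rewrite !ffunE; by [apply: h1; rewrite catE|apply: h2; rewrite catE|apply: h3; rewrite catE].
  split; elim/side_ind => x; try (elim/side_ind => y); rewrite ?catE // => xy.
  - by have := h1 _ _ xy; rewrite !ffunE.
  - by have := h1' _ _ xy; rewrite !ffunE.
  - by have := h2 _ _ xy; rewrite !ffunE.
  - by have := h2' _ _ xy; rewrite !ffunE.
  - by have := h3 _ xy; rewrite !ffunE.
  by have := h3' _ xy; rewrite !ffunE.
pose w := weight p * weight q; pose w' := weight (tensor p q).
have w0 : w != 0 by rewrite mulf_neq0 // gt_eqF // weight_gt0.
have w'0 : w' != 0 by rewrite gt_eqF // weight_gt0.
have cE j i : coef (tensor_op (T p) (T q)) j i = w * (delta (tensor p q) i j)%:R.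
  by rewrite lcoef_tensor !lcoef_Tmap // mulrACA -natrM mulnb dE.
have Tw : tensor_op (T p) (T q) = (w / w') *: T (tensor p q).
  by apply: lcoef_inj => j i; rewrite cE lcoefZ lcoef_Tmap // mulrA divfK.
have [ii _] := is_proj_tensor (Tmap_proj Pp) (Tmap_proj Qq).
have [ii' _] := Tmap_proj PQ.
pose z : midx N (k + l) := [ffun=> Ordinal hN].
have zz : delta (tensor p q) z z by apply/(deltaP _ _ PQ); split=> *; rewrite !ffunE.
move: ii; rewrite Tw -comp_lfunZl -comp_lfunZr ii' scalerA => /(congr1 (fun S => coef S z z)).
rewrite lcoefZ [RHS]lcoefZ lcoef_Tmap // zz mulr1 => /(mulIf w'0).
rewrite -[RHS]mulr1 => /(mulfI (mulf_neq0 w0 (invr_neq0 w'0))) ->.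
by rewrite scale1r.
Qed.

End Tmaps.

(** * The decomposition of $u_p\otimes u_q$ *)

Section Easy.
Variables (R : realType) (N : nat) (hN : (0 < N)%N).
Variables (C : forall k l, {set cpart k l}) (hC : category C).
Variables (G : cmqg R N) (hG : is_easy C G).
Local Notation T p := (Tmap R N p).
Local Notation U k w := (@upow R N G k w).
Local Notation Hom w := (intertwiners (@upow R N G _ w) (@upow R N G _ w)).
Local Notation PP p := (Pproj C G p).

Lemma balanced_lcol k (p : cpart k k) : balanced p -> lcol p = ucol p.
Proof. by move=> bp; apply/ffunP => x; rewrite ucolE bp; exact: ffunE. Qed.

Lemma intw_Tmap k (p : cpart k k) : p \in C k k -> projective p -> Hom (ucol p) (T p).
Proof.
move=> pC pP; apply/hG; apply: memv_span; apply: fintype.image_f.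
by have [_ /balanced_lcol lp] := projective_encodes pP; rewrite inE pC lp !eqxx.
Qed.

Definition below k (p : cpart k k) : pred (cpart k k) :=
  fun q => [&& q \in C k k, projective q & prec q p].

Lemma Tmap_preceq k (m p : cpart k k) : projective m -> projective p -> preceq m p ->
  le_proj (T m) (T p).
Proof.
move=> mP pP /(preceq_upperP pP mP)[_ r].
have [Up _] := projective_encodes pP; have [Um _] := projective_encodes mP.
exact: (Tmap_le R hN Up Um r).
Qed.

Lemma Tmap_is_proj k (p : cpart k k) : projective p -> is_proj (T p).
Proof. by move=> /projective_encodes[Up _]; exact: (Tmap_proj R hN Up). Qed.

(** The supremum in the definition of $P_p$ is written as $T_p-P_p$. *)
Lemma sup_below k (p : cpart k k) : p \in C k k -> projective p ->
  let F := T p - PP p in [/\ Hom (ucol p) F, is_proj F,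
    forall q, below p q -> le_proj (T q) F &
    forall Q, Hom (ucol p) Q -> is_proj Q -> (forall q, below p q -> le_proj (T q) Q) ->
      le_proj F Q].
Proof.
move=> pC pP /=; rewrite /Pproj opprB addrC subrK; set S := [set _ | _]%classic.
have SE : S = [set X | exists2 q, below p q & X = T q]%classic.
  apply/seteqP; split=> X /= => [[q [h1 h2 h3 ->]]|[q /and3P[h1 h2 h3] ->]]; exists q => //.
  by apply/and3P.
have tP q : below p q -> Hom (ucol p) (T q) /\ is_proj (T q).
  move=> /and3P[qC qP /andP[/andP[/eqP <- _] _]]; split; first exact: intw_Tmap.
  exact: Tmap_is_proj.
have [h1 h2 h3 h4] := sup_projP tP SE; split=> // [q bq|Q hQ pQ tQ].
  by apply: h3; rewrite SE; exists q.
by apply: h4 => // X; rewrite SE => -[q bq ->]; exact: tQ.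
Qed.

Section Pproj.
Variables (k : nat) (p : cpart k k).
Hypotheses (pC : p \in C k k) (pP : projective p).

Lemma below_preceq q : below p q -> le_proj (T q) (T p).
Proof. by case/and3P=> _ qP /andP[qp _]; exact: Tmap_preceq. Qed.

Lemma Pproj_le_sub : le_proj (T p - PP p) (T p).
Proof.
have [_ _ _ h] := sup_below pC pP; apply: h; [exact: intw_Tmap|exact: Tmap_is_proj|].
exact: below_preceq.
Qed.

Lemma Pproj_is_proj : is_proj (PP p).
Proof.
have [_ h _ _] := sup_below pC pP.
have := is_projB h (Tmap_is_proj pP) Pproj_le_sub.
by rewrite opprB addrC subrK.
Qed.

Lemma Pproj_intw : Hom (ucol p) (PP p).
Proof.
have [h _ _ _] := sup_below pC pP.
by have := intwB (intw_Tmap pC pP) h; rewrite opprB addrC subrK.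
Qed.

Lemma Pproj_le : le_proj (PP p) (T p).
Proof.
have [tt _] := Tmap_is_proj pP; have := Pproj_le_sub.
rewrite /le_proj comp_lfunDr comp_lfunNr tt => /addrI /eqP.
by rewrite eqr_opp => /eqP.
Qed.

(** $P_p$ is orthogonal to the supremum, hence to each $T_q$ below it. *)
Lemma Pproj_below q : below p q -> (PP p \o T q)%VF = 0.
Proof.
move=> bq; have [_ _ h _] := sup_below pC pP; have := h q bq.
rewrite /le_proj comp_lfunDl comp_lfunNl below_preceq // => /eqP.
by rewrite -subr_eq0 addrAC subrr add0r oppr_eq0 => /eqP.
Qed.

End Pproj.

Lemma upow_tensor k l (p : cpart k k) (q : cpart l l) i j :
  U (k + l) (ucol (tensor p q)) i j =
  U k (ucol p) (lidx i) (lidx j) * U l (ucol q) (ridx i) (ridx j).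
Proof.
rewrite /upow big_split_ord; congr (_ * _); apply: eq_bigr => a _;
  by rewrite !ucolE color_tensor_l ?side_l ?side_r !ffunE.
Qed.

Lemma lact_tensor k l (p : cpart k k) (q : cpart l l) S S' i j :
  lact (tensor_op S S') (U (k + l) (ucol (tensor p q))) i j =
  lact S (U k (ucol p)) (lidx i) (lidx j) * lact S' (U l (ucol q)) (ridx i) (ridx j).
Proof.
rewrite /lact; under eq_bigr do rewrite lcoef_tensor upow_tensor.
rewrite (sum_midx (fun a b => (coef S (lidx i) a * coef S' (ridx i) b) *:
   (U k (ucol p) a (lidx j) * U l (ucol q) b (ridx j)))) big_distrlr /=.
by apply: eq_bigr => a _; apply: eq_bigr => b _; rewrite -scalerAl -scalerAr scalerA.
Qed.

Lemma ract_tensor k l (p : cpart k k) (q : cpart l l) S S' i j :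
  ract (U (k + l) (ucol (tensor p q))) (tensor_op S S') i j =
  ract (U k (ucol p)) S (lidx i) (lidx j) * ract (U l (ucol q)) S' (ridx i) (ridx j).
Proof.
rewrite /ract; under eq_bigr do rewrite lcoef_tensor upow_tensor.
rewrite (sum_midx (fun a b => (coef S a (lidx j) * coef S' b (ridx j)) *:
   (U k (ucol p) (lidx i) a * U l (ucol q) (ridx i) b))) big_distrlr /=.
by apply: eq_bigr => a _; apply: eq_bigr => b _; rewrite -scalerAl -scalerAr scalerA.
Qed.

Lemma intw_tensor k l (p : cpart k k) (q : cpart l l) S S' :
  Hom (ucol p) S -> Hom (ucol q) S' -> Hom (ucol (tensor p q)) (tensor_op S S').
Proof.
move=> hS hS'; apply/funext => i; apply/funext => j.
by rewrite lact_tensor ract_tensor hS hS'.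
Qed.

(** By induction $E$ kills $T_n$ for all $n\prec m$, so $1-E$ dominates these $T_n$,
hence their supremum $T_m-P_m$; thus $E$ kills both terms of $T_m$. *)
Lemma kill_Tmap k (m : cpart k k) (E : 'End(fspace R (midx N k))) :
  m \in C k k -> projective m -> Hom (ucol m) E -> is_proj E ->
  (forall n, n \in C k k -> projective n -> preceq n m -> (E \o PP n)%VF = 0) ->
  (E \o T m)%VF = 0.
Proof.
have [c] := ubnP #|down_set m|.
elim: c m E => // c IH m E mc mC mP hE pE EP.
have below_kill n : below m n -> (E \o T n)%VF = 0.
  case/and3P=> nC nP nm; have [le_nm _] := andP nm.
  have [unm _] := elimT (preceq_upperP mP nP) le_nm.
  rewrite -unm in hE; have hn : (#|down_set n| < c)%N by exact: leq_trans (prec_down_set mP nP nm) mc.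
  apply: (IH n E hn nC nP hE pE) => r rC rP rn; apply: (EP r rC rP).
  exact: (preceq_trans mP nP rP rn le_nm).
have le1 : le_proj E \1%VF by rewrite /le_proj comp_lfun1l.
have : le_proj (T m - PP m) (\1%VF - E).
  have [_ _ _ h] := sup_below mC mP; apply: h => [||n /below_kill En].
  - exact: intwB (intw1 _) hE.
  - exact: is_projB pE (is_proj1 _ _) le1.
  by rewrite /le_proj comp_lfunDl comp_lfunNl comp_lfun1l En subr0.
rewrite /le_proj comp_lfunDl comp_lfunNl comp_lfun1l => /eqP.
rewrite -subr_eq0 addrAC subrr add0r oppr_eq0 comp_lfunDr comp_lfunNr.
by rewrite (EP m mC mP (preceq_refl mP)) subr0 => /eqP.
Qed.

Variables (k l : nat) (p : cpart k k) (q : cpart l l).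
Hypotheses (pC : p \in C k k) (pP : projective p) (qC : q \in C l l) (qP : projective q).

Lemma projective_tensor : projective (tensor p q).
Proof.
have [Up bp] := projective_encodes pP; have [Uq bq] := projective_encodes qP.
exact: encodes_projective (encodes_tensor_id Up Uq) (balanced_tensor bp bq).
Qed.

Local Notation x := (tensor_rep (urep C G p) (urep C G q)).
Local Notation u := (@upow R N G _ (ucol (tensor p q))).
Local Notation Q := (tensor_op (PP p) (PP q)).

Lemma proj_Q : is_proj Q.
Proof. by apply: is_proj_tensor; exact: Pproj_is_proj. Qed.

Lemma tensor_repE : x = Defs.restrict Q u.
Proof.
congr Rep; apply/funext => i; apply/funext => j; rewrite lact_tensor //.
Qed.

(** If [m] is not in $X$ then $T_m\le T_{n_1}\otimes T_{n_2}$ where $n_1\prec p$ or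
$n_2\prec q$, and $P_p$, resp. $P_q$, kills that factor. *)
Lemma Pproj_orth m : m \in C (k + l) (k + l) -> projective m -> preceq m (tensor p q) ->
  m \notin X C p q -> (Q \o PP m)%VF = 0.
Proof.
move=> mC mP mpq; rewrite inE mC mP mpq /= negb_and => mX.
have Qt n1 n2 : n1 \in C k k -> n2 \in C l l -> projective n1 -> projective n2 ->
   preceq m (tensor n1 n2) -> (PP p \o T n1)%VF = 0 \/ (PP q \o T n2)%VF = 0 ->
   (Q \o PP m)%VF = 0.
  move=> n1C n2C n1P n2P mn n0.
  have [U1 b1] := projective_encodes n1P; have [U2 b2] := projective_encodes n2P.
  have nP := encodes_projective (encodes_tensor_id U1 U2) (balanced_tensor b1 b2).
  have mn' := Tmap_preceq mP nP mn; rewrite -(Pproj_le mC mP) -mn'.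
  rewrite !comp_lfunA (Tmap_tensor R hN U1 U2) tensor_op_comp.
  case: n0 => ->; by rewrite ?tensor_op0l ?tensor_op0r !comp_lfun0l.
case/orP: mX => /forall_inPn[n nC]; rewrite negb_imply negbK => /andP[/andP[nP np] mn].
  apply: (Qt n q) => //; left; apply: Pproj_below => //; exact/and3P.
apply: (Qt p n) => //; right; apply: Pproj_below => //; exact/and3P.
Qed.

(** An intertwiner $V\le Q$ of the subrepresentation of $u$ on the range of $Q$ is an
intertwiner of $u$ itself, as $Q$ commutes with $u$. This puts $E=Q-V$ in the
intertwiner space where the suprema are taken. *)
Lemma sum_proj : is_sum_proj x (X C p q) (fun m => urep C G m).
Proof.
move=> v [pV VQ hV vE] hX.
have pQ := proj_Q; have [QQ sQ] := pQ.
move: pV VQ hV vE hX; rewrite tensor_repE; case: v => V y /= pV VQ hV [->] hX {y}.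
have hQ : Hom (ucol (tensor p q)) Q by apply: intw_tensor; exact: Pproj_intw.
have VQ' := proj_le_sym pV pQ VQ.
have hVu : Hom (ucol (tensor p q)) V.
  move: hV; rewrite /intertwiners /= -lact_comp VQ' hQ => ->.
  by rewrite -ract_comp VQ.
pose E := Q - V.
have pE : is_proj E := is_projB pV pQ VQ.
have hE : Hom (ucol (tensor p q)) E := intwB hQ hVu.
have EQ : (E \o Q)%VF = E by rewrite comp_lfunDl comp_lfunNl QQ VQ'.
have kill m : m \in C (k + l) (k + l) -> projective m -> preceq m (tensor p q) ->
    (E \o PP m)%VF = 0.
  move=> mC mP mpq; case: (boolP (m \in X C p q)) => [/hX e|mX].
    rewrite comp_lfunDl comp_lfunNl -[X in X - _]e comp_lfunA VQ' subrr //.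
  by rewrite -EQ -comp_lfunA Pproj_orth // comp_lfun0r.
have tC : tensor p q \in C (k + l) (k + l) by exact: (cat_tensor hC).
have E0 : (E \o T (tensor p q))%VF = 0 := kill_Tmap tC projective_tensor hE pE kill.
have [Up bp] := projective_encodes pP; have [Uq bq] := projective_encodes qP.
have TQ : (T (tensor p q) \o Q)%VF = Q.
  by rewrite (Tmap_tensor R hN Up Uq) tensor_op_comp !Pproj_le.
have /eqP : E = 0 by rewrite -EQ -TQ comp_lfunA E0 comp_lfun0l.
by rewrite subr_eq0 => /eqP <-; rewrite /Defs.restrict -lact_comp QQ.
Qed.

(** When the range of $P_m$ lies in that of $V\le Q$, projecting it by $Q$ does
nothing. *)
Lemma sum_proj_sum : is_sum x (X C p q) (fun m => urep C G m).
Proof.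
move=> v vx hX; apply: sum_proj => // m /hX[_ Pv _ _].
have [_ VQ _ _] := vx.
have xP : (rproj x \o rproj (urep C G m))%VF = rproj (urep C G m).
  by rewrite -Pv comp_lfunA VQ.
by rewrite xP.
Qed.
End Easy.

Local Close Scope ring_scope.

Theorem theorem6p8 (R : realType) (N : nat) (hN : (0 < N)%N)
    (C : forall k l, {set cpart k l}) (hC : category C)
    (G : cmqg R N) (hG : is_easy C G)
    (k l : nat) (p : cpart k k) (q : cpart l l)
    (pC : p \in C k k) (pP : projective p)
    (qC : q \in C l l) (qP : projective q) :
  (is_sum (tensor_rep (urep C G p) (urep C G q)) (X C p q)
     (fun m => urep C G m) /\
   is_sum_proj (tensor_rep (urep C G p) (urep C G q)) (X C p q)
     (fun m => urep C G m)) /\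
  X C p q = Y p q :&: C (k + l)%N (k + l)%N.
Proof.
split; last exact: X_eq_YC.
by split; [apply: sum_proj_sum | apply: sum_proj].
Qed.
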